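(* Let $L$ satisfy assumptions (L1), (L2'), (L3) stated in the context. Let $u_0\in\mathbb{R}$ and $R>0$ be fixed. Then there exists a continuous function $F=F_{u_0,R}:[0,+\infty)\times[0,+\infty)\to[0,+\infty)$, with $F(t,r)$ nondecreasing in both variables and superlinear with respect to $r$, such that for any $t>0$ and $x,x_0\in\mathbb{R}^n$ with $|x-x_0|\leqslant R$, every minimizer $\xi\in\Gamma^t_{x_0,x}$ of $J$ over $\mathcal{A}$ satisfies $$\operatorname*{ess\,sup}_{s\in[0,t]}|\dot\xi(s)|\leqslant F(t,R/t).$$
   Context: Standing assumptions: $L:\mathbb{R}^n\times\mathbb{R}\times\mathbb{R}^n\to\mathbb{R}$, $(x,r,v)\mapsto L(x,r,v)$, is of class $C^2$ and satisfies: (L1) $L(x,r,\cdot)$ is strictly convex for all $(x,r)\in\mathbb{R}^n\times\mathbb{R}$. (L2') There exist two superlinear nondecreasing functions $\overline\theta_0,\theta_0:[0,+\infty)\to[0,+\infty)$ with $\theta_0(0)=0$, and $c_0>0$, such that $\overline\theta_0(|v|)\geqslant L(x,0,v)\geqslant\theta_0(|v|)-c_0$ for all $(x,v)\in\mathbb{R}^n\times\mathbb{R}^n$. Moreover there exists $R_0>1$ and, for each compact $A\subset\mathbb{R}^n$, a constant $C_A>0$ such that $L(x,0,\rho v)\leqslant C_A(1+L(x,0,v))$ for all $\rho\in[1,R_0]$ and $(x,v)\in A\times\mathbb{R}^n$. (L3) There exists $K>0$ such that $|L_r(x,r,v)|\leqslant K$ for all $(x,r,v)$, where $L_r=\partial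 L/\partial r$. A function $\theta$ on $[0,+\infty)$ is superlinear if $\theta(\rho)/\rho\to+\infty$ as $\rho\to+\infty$. Notation: for $x_0,x\in\mathbb{R}^n$, $t>0$, $\Gamma^t_{x_0,x}=\{\xi\in W^{1,1}([0,t],\mathbb{R}^n):\xi(0)=x_0,\ \xi(t)=x\}$. $\mathcal{A}$ (depending on $x_0,x,t,u_0$) is the set of $\xi\in\Gamma^t_{x_0,x}$ for which $\dot u_\xi(s)=L(\xi(s),u_\xi(s),\dot\xi(s))$ a.e. on $[0,t]$, $u_\xi(0)=u_0$, admits an absolutely continuous solution $u_\xi$ on $[0,t]$ (which is then unique). For $\xi\in\mathcal{A}$, $J(\xi)=\int_0^tL(\xi(s),u_\xi(s),\dot\xi(s))\,ds=u_\xi(t)-u_0$. *)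

(* Defs.v *)
From HB Require Import structures.
From mathcomp Require Import all_boot all_order all_algebra.
From mathcomp Require Import all_classical all_reals all_analysis ess_sup_inf.

Set Implicit Arguments.
Unset Strict Implicit.
Unset Printing Implicit Defensive.

Import Order.TTheory GRing.Theory Num.Theory.
Import numFieldNormedType.Exports.

Local Open Scope classical_set_scope.
Local Open Scope ring_scope.

(** The norm [`|v|] of the library on ['rV[R]_n] is the sup norm (it induces
    the same topology); the Euclidean norm has to be defined. *)
Definition enorm (R : realType) (n : nat) (v : 'rV[R]_n) : R :=
  Num.sqrt (\sum_(i < n) v 0 i ^+ 2).

(** Class C^k; the domain is meant to be finite-dimensional, so that
    continuity of all the directional derivatives amounts to continuity of the
    differential. *)
Fixpoint classC (R : realType) (V : normedModType R) (k : nat) (f : V -> R)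
    : Prop :=
  if k is k'.+1 then
    (forall x, differentiable f x) /\ (forall v, classC k' (fun x => 'D_v f x))
  else continuous f.

Definition strictly_convex (R : realType) (V : lmodType R) (f : V -> R) : Prop :=
  forall (v w : V) (l : R), v != w -> 0 < l < 1 ->
    f (l *: v + (1 - l) *: w) < l * f v + (1 - l) * f w.

Definition superlinear (R : realType) (theta : R -> R) : Prop :=
  theta rho / rho @[rho --> +oo] --> +oo.

(** A function from [[0, +oo[] to [[0, +oo[] is a function on [R] of which only
    the values on [[0, +oo[] matter. *)
Definition superlinear_bound (R : realType) (theta : R -> R) : Prop :=
  [/\ forall rho, 0 <= rho -> 0 <= theta rho,
      forall rho sigma, 0 <= rho -> rho <= sigma -> theta rho <= theta sigma
    & superlinear theta].

Section Lagrangian.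
Variables (R : realType) (n : nat) (L : 'rV[R]_n -> R -> 'rV[R]_n -> R).

Definition lagrangian_C2 : Prop :=
  classC 2 (fun p : 'rV[R]_n * R * 'rV[R]_n => L p.1.1 p.1.2 p.2).

Definition cond_L1 : Prop := forall x r, strictly_convex (L x r).

Definition cond_L2' : Prop :=
  (exists (theta1 theta0 : R -> R) (c0 : R),
    [/\ superlinear_bound theta1,
        superlinear_bound theta0,
        theta0 0 = 0,
        0 < c0
      & forall x v, theta0 (enorm v) - c0 <= L x 0 v <= theta1 (enorm v)]) /\
  (exists R0 : R, 1 < R0 /\
    forall A : set 'rV[R]_n, compact A ->
    exists C : R, 0 < C /\
      forall (rho : R) x v, 1 <= rho <= R0 -> A x ->
        L x 0 (rho *: v) <= C * (1 + L x 0 v)).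

Definition cond_L3 : Prop :=
  exists K : R, 0 < K /\ forall x r v, `| derive1 (L x ^~ v) r | <= K.

End Lagrangian.

(** Test functions on the open interval, extended by 0 to [R]; a closed support
    inside the bounded interval is automatically compact. *)
Definition test_function (R : realType) (a b : R) (phi : R -> R) : Prop :=
  classC 1 phi /\ closure [set s | phi s != 0] `<=` `]a, b[.

Section Sobolev.
Variables (R : realType) (n : nat) (a b : R).
Local Notation mu := (@lebesgue_measure R).

Definition L1_curve (f : R -> 'rV[R]_n) : Prop :=
  forall i, mu.-integrable `[a, b] (fun s => (f s 0 i)%:E).

Definition is_weak_derivative (f g : R -> 'rV[R]_n) : Prop :=
  forall phi, test_function a b phi -> forall i,
    \int[mu]_(s in `[a, b]) (f s 0 i * derive1 phi s) =
    - \int[mu]_(s in `[a, b]) (g s 0 i * phi s).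

(** The elements of W^{1,1} are represented by their continuous
    representatives, so that their values at points (in particular at the ends
    of the interval) make sense.  Only the restriction of a curve to [[a, b]]
    matters. *)
Definition W11 (f : R -> 'rV[R]_n) : Prop :=
  [/\ {within `[a, b], continuous f}, L1_curve f
    & exists g, L1_curve g /\ is_weak_derivative f g].

(** Determined up to a null set on [[a, b]] when [f] is in W^{1,1}. *)
Definition weak_derivative (f : R -> 'rV[R]_n) : R -> 'rV[R]_n :=
  xget (cst 0) [set g | L1_curve g /\ is_weak_derivative f g].

End Sobolev.

Definition absolutely_continuous (R : realType) (a b : R) (f : R -> R) : Prop :=
  forall e : R, 0 < e -> exists d : R, 0 < d /\
    forall (m : nat) (I : 'I_m -> R * R),
      (forall i, a <= (I i).1 /\ (I i).1 <= (I i).2 /\ (I i).2 <= b) ->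
      trivIset setT (fun i => `](I i).1, (I i).2[%classic) ->
      \sum_(i < m) ((I i).2 - (I i).1) < d ->
      \sum_(i < m) `| f (I i).2 - f (I i).1 | < e.

Section Herglotz.
Variables (R : realType) (n : nat) (L : 'rV[R]_n -> R -> 'rV[R]_n -> R).
Variables (x0 x : 'rV[R]_n) (t u0 : R).
Local Notation mu := (@lebesgue_measure R).
Implicit Types (xi : R -> 'rV[R]_n) (u : R -> R).

Definition Gamma : set (R -> 'rV[R]_n) :=
  [set xi | [/\ W11 0 t xi, xi 0 = x0 & xi t = x]].

Definition herglotz_solution xi u : Prop :=
  [/\ absolutely_continuous 0 t u, u 0 = u0
    & {ae mu, forall s, s \in `[0, t] ->
        is_derive s 1 u (L (xi s) (u s) (weak_derivative 0 t xi s))}].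

Definition admissible : set (R -> 'rV[R]_n) :=
  [set xi | Gamma xi /\ exists u, herglotz_solution xi u].

(** Only the values on [[0, t]] are meaningful (and uniquely determined). *)
Definition u_of xi : R -> R := xget (cst 0) [set u | herglotz_solution xi u].

Definition action xi : R :=
  \int[mu]_(s in `[0, t])
    L (xi s) (u_of xi s) (weak_derivative 0 t xi s).

Definition minimizer xi : Prop :=
  admissible xi /\ forall eta, admissible eta -> action xi <= action eta.

End Herglotz.

Definition ess_sup_on (R : realType) (a b : R) (f : R -> R) : \bar R :=
  ess_sup (mrestr (@lebesgue_measure R) (measurable_itv `[a, b]))
    (fun s => (f s)%:E).

(* Main.v *)
(** A minimizer [xi] with Herglotz solution [u] is compared with two competitors.
    The straight segment bounds [u t] from above, and variation of constants in
    [u' = L (xi, u, xi')] (where [|L_r| <= K]) turns this into a bound on the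
    integral of [theta0 (|xi'|)] and on [|u|].  By superlinearity, [|xi'| <= r0]
    on half of [[0, t]], while the set [E = {|xi'| > M}] carries little of the
    integral of [|xi'|].  If [E] were not negligible, one could run through the
    same curve in the same time with speed 1 on [E], paying for the delay by an
    acceleration of ratio at most 2 on [{|xi'| <= r0}].  On [E] this saves at
    least [(q - B) |xi'|] with [q] arbitrarily large, elsewhere it costs at most
    a constant times the delay, so that the new curve has a smaller action.  All
    the constants are uniform for [t] in a compact subset of [(0, +oo)]; only
    convexity and the first half of (L2') are involved, hence the bounds do not
    depend on the position of [x0].

    The Herglotz equation of the new curve is solved in the old time variable by
    Picard iteration.  Absolutely continuous functions are handled through the
    predicate [primitive a b f g]: [g] is integrable and [f] is its integral. *)

Require Import Defs.
From HB Require Import structures.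
From mathcomp Require Import all_boot all_order all_algebra.
From mathcomp Require Import all_classical all_reals all_analysis ess_sup_inf measurable_realfun.
From mathcomp Require Import ring lra.
Set Implicit Arguments.
Unset Strict Implicit.
Unset Printing Implicit Defensive.
Import Order.TTheory GRing.Theory Num.Theory.
Import numFieldNormedType.Exports.
Local Open Scope classical_set_scope.
Local Open Scope ring_scope.

(** * Absolutely continuous functions *)

(** The competitor is determined by the density [al] of its time with respect to the old one:
    [al = |xi'|] on [E], [al = 1 - d] on the slow set, [al = 1] in between, where [d] is fixed by
    requiring the integral of [al] to be [t]. The obstacle is that [L] depends on [u]: a gain on [E]
    alters the equation at all later times. Both solutions are therefore compared in the old time.
    The new one satisfies [w' = al L(xi, w, xi'/al)], and [w - u] solves a linear inequality whose
    source [al L(xi, u, xi'/al) - L(xi, u, xi')] is frozen at the old [u], which is already bounded.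
    The integrating factor lies between [1/e0] and [e0] with [e0 = exp(K b)], so the balance of gain
    and cost becomes the condition [B + e0^2 B' < q]. There is no circularity in the constants: [C4]
    and [U] come from the segment, then [r0] fixes [B'], then [q] is chosen, then [M]. A minimizer
    is only known to be in W^{1,1}, so values of [L] are compared instead of derivatives, and
    convexity enters through the secant from [v] to [2 v]. *)

(** The supremum of the points reached is the only place where the induction could stop, and [step]
    at that point carries [P] from just left of it to just right of it. It takes the place of a
    covering argument in [ac_derive_ge0_le]. *)
Lemma real_induction (R : realType) (a b : R) (P : R -> Prop) : a <= b -> P a ->
  (forall c, a <= c <= b -> exists2 r, 0 < r & forall s s',
     a <= s -> s <= c -> c <= s' -> s' <= b -> c - r < s -> s' < c + r ->
     P s -> P s') -> P b.
Proof.
move=> ab Pa step.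
pose S := [set s | a <= s <= b /\ P s].
have Sa : S a by split => //; rewrite lexx.
have supS : has_sup S.
  split; first by exists a.
  by exists b => x [/andP[]].
have ac : a <= sup S by exact: (ub_le_sup supS.2 Sa).
have cb : sup S <= b by apply: (ge_sup supS.1) => x [/andP[]].
have [|r r0 Hr] := step (sup S); first by rewrite ac.
have [s [/andP[as_ sb] Ps] rs] := sup_adherent r0 supS.
have sS : s <= sup S by apply: (ub_le_sup supS.2); split => //; rewrite as_.
pose c' := Num.min b (sup S + r / 2).
have c'b : c' <= b by rewrite /c' ge_min lexx.
have cc' : sup S <= c' by rewrite /c' le_min cb lerDl; lra.
have c'r : c' < sup S + r.
  rewrite (@le_lt_trans _ _ (sup S + r / 2))//; last lra.
  by rewrite /c' ge_min lexx orbT.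
have Pc' : P c' by exact: (Hr s).
have : c' <= sup S.
  by apply: (ub_le_sup supS.2); split => //; rewrite c'b (le_trans ac).
have [bs|bs] := leP b (sup S + r / 2); first by move=> _; rewrite -(min_idPl bs).
by rewrite /c' (min_idPr (ltW bs)); lra.
Qed.

(** * Monotonicity from an almost everywhere nonnegative derivative *)

Section nondecreasing.
Context {R : realType}.
Local Notation mu := (@lebesgue_measure R).

(** The two one-sided difference quotients are added, so that the estimate holds on every small
    interval containing [s] and not only on those ending at [s]; this is the form that
    [real_induction] consumes. *)
Lemma derive_ge0_near (f : R -> R) (s d e : R) : 0 <= d -> 0 < e ->
  is_derive s 1 f d -> exists2 r, 0 < r & forall x y,
    s - r < x -> x <= s -> s <= y -> y < s + r ->
    - e * (y - x) <= f y - f x.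
Proof.
move=> d0 e0 [df dfd].
have : h^-1 *: ((f \o shift s) (h *: 1) - f s) @[h --> 0^'] --> d.
  by rewrite -dfd; exact: df.
move=> /cvgrPdist_lt/(_ _ e0)[r/= r0 Hr].
exists r => // x y rx xs sy yr.
have key h : h != 0 -> `|h| < r -> - e < h^-1 * (f (h + s) - f s).
  move=> h0 hr; have := Hr h; rewrite /= sub0r normrN => /(_ hr h0).
  rewrite /= /shift /= [h *: 1]mulr1 ; rewrite ltr_distl => /andP[_].
  rewrite -[_ *: _]/(h^-1 * _); lra.
have Hy : - e * (y - s) <= f y - f s.
  have [->|ys] := eqVneq y s; first by rewrite !subrr mulr0.
  have yso : 0 < y - s by rewrite subr_gt0 lt_neqAle eq_sym ys.
  have := key (y - s); rewrite gt_eqF// gtr0_norm// subrK ltrBlDl => /(_ isT yr).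
  by rewrite mulrC -ltr_pdivrMr ?invr_gt0// invrK => /ltW.
have Hx : - e * (s - x) <= f s - f x.
  have [->|ys] := eqVneq x s; first by rewrite !subrr mulr0.
  have yso : x - s < 0 by rewrite subr_lt0 lt_neqAle ys.
  have := key (x - s); rewrite lt_eqF// ltr0_norm// subrK opprB ltrBlDl -ltrBlDr => /(_ isT rx).
  rewrite mulrC -ltr_ndivlMr ?invr_lt0// invrK => /ltW; lra.
lra.
Qed.

(** The exceptional null set is enclosed in an open set [O] so small that absolute continuity makes
    the variation of [f] over intervals of [O] less than [e]; everywhere else [f] loses at most [e]
    per unit length. *)
Lemma ac_derive_ge0_le (a b : R) (f : R -> R) : a <= b ->
  absolutely_continuous a b f ->
  {ae mu, forall s, s \in `[a, b] -> exists2 d, 0 <= d & is_derive s 1 f d} ->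
  f a <= f b.
Proof.
move=> ab acf [N [mN N0 subN]].
suff H (e : R) : 0 < e -> f a <= f b + e * (b - a) + e.
  apply/ler_addgt0Pl => e e0.
  have e1 : 0 < e / (b - a + 1) by rewrite divr_gt0//; lra.
  have -> : e + f b = f b + (e / (b - a + 1)) * (b - a) + e / (b - a + 1).
    field; lra.
  exact: H.
move=> e0; have [d [d0 Hd]] := acf e e0.
have [|O [oO NO]] := @lebesgue_regularity_outer R N d mN _ d0.
  by rewrite -[X in (X < _)%E]/(mu N) N0 ltry.
move=> HO; have mO : measurable O by exact: open_measurable.
have {}HO : (mu O < d%:E)%E.
  rewrite (@measureDI _ _ _ mu O N mO mN)/=.
  rewrite (@subset_measure0 _ _ _ mu (O `&` N) N)//; last exact: measurableI.
  by rewrite adde0.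
pose m' s := fine (mu (O `&` `[a, s])).
have mfin s : mu (O `&` `[a, s]) \is a fin_num.
  rewrite ge0_fin_numE// (le_lt_trans _ (lt_trans HO (ltry _)))//.
  by apply: le_measure; rewrite ?inE//; exact: measurableI.
(* The intervals of the family are those on which the decrease of [f] is not controlled by a
   derivative. Their total length is charged to the part of [O] left of [s], hence stays below
   [d]. *)
pose P s := exists m (I : nat -> R * R),
  [/\ forall i, (i < m)%N -> [/\ a <= (I i).1, (I i).1 <= (I i).2 & (I i).2 <= s],
      forall i j, (i < j)%N -> (j < m)%N -> (I i).2 <= (I j).1,
      \sum_(i < m) ((I i).2 - (I i).1) <= m' s &
      f a <= f s + e * (s - a) + \sum_(i < m) `|f (I i).2 - f (I i).1| ].
suff [m [I [Iab Itriv Im Hf]]] : P b.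
  apply: (le_trans Hf); rewrite lerD2l; apply/ltW.
  apply: (Hd m (fun i => I i)).
  - by move=> i; have [] := Iab i (ltn_ord i).
  - apply/trivIsetP => i j _ _.
    wlog ij : i j / (i < j)%N.
      move=> W; rewrite neq_ltn => /orP[ij|ji]; first by apply: W => //; rewrite neq_ltn ij.
      by rewrite setIC; apply: W => //; rewrite neq_ltn ji.
    move=> _; apply/seteqP; split => // x [/=]; rewrite !in_itv/= => /andP[_ h1] /andP[h2 _].
    by have := Itriv i j ij (ltn_ord j); lra.
  - apply: (le_lt_trans Im); rewrite /m' -lte_fin fineK// (le_lt_trans _ HO)//.
    by apply: le_measure; rewrite ?inE//; exact: measurableI.
apply: (@real_induction _ a b) => //.
  exists 0%N, (fun=> (0, 0)); split => //; first by rewrite big_ord0 /m' fine_ge0.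
  by rewrite big_ord0 subrr mulr0 !addr0.
move=> c acb.
have m'D s s' : a <= s -> s <= s' -> `]s, s'] `<=` O -> m' s + (s' - s) <= m' s'.
  move=> as_ ss' sub; rewrite /m' -lee_fin EFinD !fineK//.
  have -> : ((s' - s)%:E = mu `]s, s'])%E.
    rewrite lebesgue_measure_itv/= lte_fin; case: ltP => // h.
    by rewrite EFinB [in LHS](_ : s' = s) ?subee//; apply/eqP; rewrite eq_le h.
  rewrite -measureU//; last 2 first.
    exact: measurableI.
    apply/seteqP; split => // x [[_]]/=; rewrite !in_itv/=; lra.
  apply: le_measure; rewrite ?inE//.
    by apply: measurableU => //; exact: measurableI.
    exact: measurableI.
  move=> x [[Ox]|] /=; rewrite !in_itv/= => h.
    by split => //; rewrite /= ?in_itv/=; lra.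
  by split; [apply: sub; rewrite /= ?in_itv/=|rewrite /= ?in_itv/=; lra].
have m'S s s' : s <= s' -> m' s <= m' s'.
  move=> ss'; rewrite /m' fine_le//; apply: le_measure; rewrite ?inE//.
  - exact: measurableI.
  - exact: measurableI.
  by move=> x [Ox]/=; rewrite !in_itv/= => h; split => //; rewrite /= ?in_itv/=; lra.
(* Near a point of [N] the stretch from [s] to [s'] lies in [O]: it joins the family, and the growth
   of [m'] pays for its length. Elsewhere the derivative bounds the loss by [e * (s' - s)] and the
   family is kept. *)
have [cN|cN] := pselect (N c).
  have /nbhs_ballP[r/= r0 Hr] : nbhs c O by exact/open_nbhs_nbhs/(conj oO)/NO.
  exists r => // s s' as_ sc cs' s'b rs s'r [m [I [Iab Itriv Im Hf]]].
  have sub : `]s, s'] `<=` O.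
    move=> x/=; rewrite in_itv/= => h; apply: Hr; rewrite /ball/= ltr_distl; lra.
  exists m.+1, (fun i => if i == m then (s, s') else I i); split.
  - move=> i; rewrite ltnS leq_eqVlt; case: eqP => [->/=|_ /= im]; first by split; lra.
    by have [? ? ?] := Iab i im; split; lra.
  - move=> i j ij; rewrite ltnS => jm; rewrite (ltn_eqF (leq_trans ij jm)).
    move: jm; rewrite leq_eqVlt => /predU1P[jm|jm].
      by rewrite jm eqxx/=; rewrite jm in ij; have [] := Iab i ij; lra.
    by rewrite ltn_eqF//; exact: Itriv.
  - rewrite big_ord_recr/= eqxx/=.
    under eq_bigr do rewrite ltn_eqF//.
    by apply: le_trans (m'D s s' as_ (le_trans sc cs') sub); rewrite lerD2r.
  - rewrite big_ord_recr/= eqxx/=.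
    under eq_bigr do rewrite ltn_eqF//.
    have h1 : f s <= f s' + `|f s' - f s|.
      by rewrite addrC -lerBlDr distrC ler_norm.
    have : e * (s - a) <= e * (s' - a) by rewrite ler_pM2l//; lra.
    lra.
have [dc dc0 fc] : exists2 d, 0 <= d & is_derive c 1 f d.
  by apply: contrapT => h; apply: cN; apply: subN => /= /(_ _)h'; apply: h; apply: h'; rewrite in_itv/= acb.
have [r r0 Hr] := derive_ge0_near dc0 e0 fc.
exists r => // s s' as_ sc cs' s'b rs s'r [m [I [Iab Itriv Im Hf]]].
exists m, I; split => //.
- by move=> i im; have [? ? ?] := Iab i im; split; lra.
- by apply: (le_trans Im); apply: m'S; lra.
- by have := Hr s s' rs sc cs' s'r; lra.
Qed.

End nondecreasing.

(** * The fundamental theorem of calculus for absolutely continuous functions *)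

Section ac.
Context {R : realType}.
Local Notation mu := (@lebesgue_measure R).
Implicit Types (a b : R) (f g h : R -> R).

(** The common source of all the closure properties used later: sums, products, exponentials and
    Lipschitz functions differ only in the increment inequality. *)
Lemma ac_dom a b C f g h :
  (forall x y, a <= x -> x <= y -> y <= b ->
     `|h y - h x| <= C * (`|f y - f x| + `|g y - g x|)) ->
  absolutely_continuous a b f -> absolutely_continuous a b g ->
  absolutely_continuous a b h.
Proof.
move=> H acf acg e e0.
have C0 : 0 < `|C| + 1 by rewrite ltr_wpDl.
have e1 : 0 < e / (2 * (`|C| + 1)) by rewrite divr_gt0// mulr_gt0.
have [d1 [d10 H1]] := acf _ e1; have [d2 [d20 H2]] := acg _ e1.
exists (Num.min d1 d2); split; first by rewrite lt_min d10.
move=> m I Iab Itriv; rewrite lt_min => /andP[/(H1 _ _ Iab Itriv) {}H1 /(H2 _ _ Iab Itriv) {}H2].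
apply: (@le_lt_trans _ _ ((`|C| + 1) * (\sum_(i < m) `|f (I i).2 - f (I i).1| + \sum_(i < m) `|g (I i).2 - g (I i).1|))).
  rewrite -big_split/= mulr_sumr; apply: ler_sum => i _.
  have [? [? ?]] := Iab i; apply: (le_trans (H _ _ _ _ _)) => //.
  by rewrite ler_wpM2r ?addr_ge0// (le_trans (ler_norm C))// lerDl.
have -> : e = (`|C| + 1) * (e / (2 * (`|C| + 1)) + e / (2 * (`|C| + 1))).
  by field; rewrite gt_eqF.
by rewrite ltr_pM2l// ltrD.
Qed.

Lemma acS a b a' b' f : a <= a' -> b' <= b ->
  absolutely_continuous a b f -> absolutely_continuous a' b' f.
Proof.
move=> aa' bb' acf e e0; have [d [d0 H]] := acf e e0.
exists d; split => // m I Iab; apply: H => i.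
have [? [? ?]] := Iab i; split; first by lra.
by split => //; lra.
Qed.

Lemma ac_id a b : absolutely_continuous a b (fun x : R => x).
Proof.
move=> e e0; exists e; split => // m I Iab _ h; apply: le_lt_trans h.
by apply: ler_sum => i _; have [? [? ?]] := Iab i; rewrite ger0_norm// subr_ge0.
Qed.

Lemma lipschitz_ac a b C f :
  (forall x y, a <= x -> x <= y -> y <= b -> `|f y - f x| <= C * (y - x)) ->
  absolutely_continuous a b f.
Proof.
move=> H; apply: (@ac_dom a b (C / 2) id id); [|exact: ac_id|exact: ac_id].
move=> x y ax xy yb; apply: (le_trans (H _ _ ax xy yb)).
by rewrite ger0_norm ?subr_ge0//=; lra.
Qed.

Lemma ac_dist a b f e : absolutely_continuous a b f -> 0 < e ->
  exists2 d, 0 < d & forall x y, a <= x -> x <= y -> y <= b -> y - x < d ->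
    `|f y - f x| < e.
Proof.
move=> acf e0; have [d [d0 H]] := acf e e0; exists d => // x y ax xy yb yxd.
have := H 1%N (fun=> (x, y)); rewrite !big_ord1; apply => //.
by apply/trivIsetP => i j _ _; rewrite (ord1 i) (ord1 j) eqxx.
Qed.

Lemma ac_continuous a b f : absolutely_continuous a b f ->
  {within `[a, b], continuous f}.
Proof.
move=> acf; apply/subspace_continuousP => x /=; rewrite in_itv/= => xab.
apply/cvgrPdist_lt => e e0; have [d d0 H] := ac_dist acf e0.
apply/nbhs_ballP; exists d => // y; rewrite /ball/= ltr_distl => hy.
rewrite in_itv/= => yab.
have [xy|yx] := leP x y; first by rewrite distrC; apply: H; lra.
by apply: H; lra.
Qed.

Lemma continuous_within_bounded a b f : {within `[a, b], continuous f} ->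
  exists2 C, 0 <= C & forall x, a <= x <= b -> `|f x| <= C.
Proof.
move=> cf; have [ab|ab] := leP a b; last by exists 0 => // x; lra.
have : compact (f @` `[a, b]) by apply: continuous_compact => //; exact: segment_compact.
move=> /compact_bounded[M [_ HM]]; exists (`|M| + 1) => [|x xab].
  by rewrite addr_ge0.
by apply: (HM (`|M| + 1)); [rewrite ltr_pwDr// ler_norm|exists x; rewrite //= in_itv].
Qed.

Lemma continuous_within_measurable a b f : {within `[a, b], continuous f} ->
  measurable_fun `[a, b] f.
Proof. by move=> cf; exact: subspace_continuous_measurable_fun. Qed.

Lemma integrable_mul_bounded (D : set R) C f g : measurable D ->
  mu.-integrable D (EFin \o f) -> measurable_fun D g ->
  (forall x, D x -> `|g x| <= C) -> mu.-integrable D (EFin \o (f \* g)).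
Proof.
move=> mD If mg bg; have -> : EFin \o (f \* g) = ((EFin \o f) \* (EFin \o g))%E.
  by apply/funext => x /=; rewrite EFinM.
apply: integrableMl => //; exists C; split; first exact: num_real.
by move=> M CM x Dx /=; rewrite (le_trans (bg _ Dx))// ltW.
Qed.

Lemma integrable_mul_continuous a b f g :
  mu.-integrable `[a, b] (EFin \o f) -> {within `[a, b], continuous g} ->
  mu.-integrable `[a, b] (EFin \o (f \* g)).
Proof.
move=> If cg; have [C _ HC] := continuous_within_bounded cg.
apply: (@integrable_mul_bounded _ C) => //; first exact: continuous_within_measurable.
Qed.

Lemma integrable_sub_itv a b a' b' f : a <= a' -> b' <= b ->
  mu.-integrable `[a, b] (EFin \o f) -> mu.-integrable `[a', b'] (EFin \o f).
Proof.
move=> aa' bb'; apply: integrableS => // x /=; rewrite !in_itv/=; lra.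
Qed.

Lemma Rintegral_itv_sub a x y f : a <= x -> x <= y ->
  mu.-integrable `[a, y] (EFin \o f) ->
  \int[mu]_(s in `[a, y]) f s - \int[mu]_(s in `[a, x]) f s =
  \int[mu]_(s in `[x, y]) f s.
Proof.
move=> ax xy If; rewrite Rintegral_itvB ?bnd_simp//.
rewrite Rintegral_itv_obnd_cbnd//.
by apply: integrableS If => //; move=> z /=; rewrite !in_itv/=; lra.
Qed.

(** The absolute continuity of the integral as a set function, applied to the union of the
    intervals; [f] is extended by 0 to have an integrable function on the line. *)
Lemma int_ac a b f : mu.-integrable `[a, b] (EFin \o f) ->
  absolutely_continuous a b (fun s => \int[mu]_(x in `[a, s]) f x).
Proof.
move=> If e e0; pose g := f \_ `[a, b].
have Ig : mu.-integrable setT (EFin \o g).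
  by rewrite /g -restrict_EFin; apply/integrable_restrict => //=; rewrite setTI.
have [d [d0 H]] := integral_normr_continuous Ig e0.
exists d; split => // m I Iab Itriv Id.
pose J (i : 'I_m) : set R := `](I i).1, (I i).2[%classic.
have mJ i : measurable (J i) by exact: measurable_itv.
pose A := \big[setU/set0]_(i < m) J i.
have mA : measurable A by apply: bigsetU_measurable => i _; exact: measurable_itv.
have muJ i : (mu (J i) = ((I i).2 - (I i).1)%:E)%E.
  rewrite lebesgue_measure_itv/= lte_fin; have [? [? ?]] := Iab i.
  by case: ltP => // h; rewrite [X in _ = X%:E](_ : _ = 0)//; lra.
have muA : (mu A < d%:E)%E.
  rewrite [X in (X < _)%E](_ : _ = \sum_(i < m) mu (J i))%E.
    by under eq_bigr do rewrite muJ; rewrite sumEFin lte_fin.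
    by have := @measure_bigsetU_ord _ _ _ mu m xpredT J; rewrite /A; apply => // i; exact: measurable_itv.
apply: le_lt_trans (H _ mA muA).
have IJ i : mu.-integrable (J i) (EFin \o f).
  apply: (integrableS _ _ _ If); [exact: measurable_itv|exact: mJ|move=> z].
  have [? [? ?]] := Iab i.
  by rewrite /J /= !in_itv/=; lra.
have gJ i z : J i z -> g z = f z.
  have [? [? ?]] := Iab i; rewrite /J/= in_itv/= => Jz.
  by rewrite /g patchE mem_set//= in_itv/=; lra.
have -> : \int[mu]_(x in A) `|g x| = \sum_(i < m) \int[mu]_(x in J i) `|f x|.
  have mgA : measurable_fun A (fun x => `|g x|%:E).
    apply/measurable_EFinP/measurableT_comp => //.
    by apply: (measurable_funS measurableT) => //; have /measurable_int/measurable_EFinP := Ig.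
  have idx : [set` index_enum 'I_m] = setT :> set 'I_m.
    by apply/seteqP; split => // i _ /=; rewrite mem_index_enum.
  have -> : (\int[mu]_(x in A) `|g x| = fine (\sum_(i < m) \int[mu]_(x in J i) `|g x|%:E)%E)%R.
    have := @ge0_integral_bigsetU _ _ _ mu _ J (fun x => `|g x|%:E) (index_enum 'I_m).
    by rewrite idx /Rintegral => -> //; exact: index_enum_uniq.
  rewrite -sum_fine => [|i _].
    apply: eq_bigr => i _; congr fine; apply: eq_integral => z; rewrite inE => /gJ ->//.
  have -> : (\int[mu]_(x in J i) `|g x|%:E = \int[mu]_(x in J i) `|f x|%:E)%E.
    by apply: eq_integral => z; rewrite inE => /gJ ->.
  by apply: integrable_fin_num; [exact: mJ|exact: (integrable_norm (IJ i))].
apply: ler_sum => i _; have [? [? ?]] := Iab i.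
rewrite Rintegral_itv_sub//; last by apply: integrable_sub_itv If.
have -> : \int[mu]_(s in `[(I i).1, (I i).2]) f s = \int[mu]_(s in J i) f s.
  rewrite -Rintegral_itv_obnd_cbnd; last first.
    by apply: integrableS If => // z /=; rewrite !in_itv/=; lra.
  by rewrite -Rintegral_itv_bndo_bndc//; exact: IJ.
by apply: le_normr_Rintegral; [exact: mJ|exact: IJ].
Qed.

Lemma ae_conj (P Q : R -> Prop) : {ae mu, forall x, P x} -> {ae mu, forall x, Q x} ->
  {ae mu, forall x, P x /\ Q x}.
Proof. by move=> HP HQ; apply: filterI; first exact: (ae_filter_ringOfSetsType mu). Qed.

Lemma ae_imp (P Q : R -> Prop) : (forall x, P x -> Q x) -> {ae mu, forall x, P x} ->
  {ae mu, forall x, Q x}.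
Proof. by move=> PQ; apply: filterS; first exact: (ae_filter_ringOfSetsType mu). Qed.

Lemma ae_neq a : {ae mu, forall x, x != a}.
Proof.
exists [set a]; split => //; first exact: lebesgue_measure_set1.
by move=> x /=; apply: contra_notP => /eqP.
Qed.

(** Lebesgue differentiation of the extension of [f] by 0. The endpoints, where a two-sided
    derivative looks outside [[a, b]], are discarded as a null set. *)
Lemma int_ae_derive a b f : mu.-integrable `[a, b] (EFin \o f) ->
  {ae mu, forall s, s \in `[a, b] ->
    is_derive s 1 (fun s => \int[mu]_(x in `[a, s]) f x) (f s)}.
Proof.
move=> If; pose g := f \_ `[a, b].
have Ig : mu.-integrable setT (EFin \o g).
  by rewrite /g -restrict_EFin; apply/integrable_restrict => //=; rewrite setTI.
have Iy y : mu.-integrable [set` Interval (BLeft a) (BRight y)] (EFin \o g).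
  by apply: integrableS Ig.
have lg : locally_integrable [set: R] g by exact: integrable_locally.
have {lg Iy}H : {ae mu, forall x, a < x -> derivable (fun s => \int[mu]_(x in `[a, s]) g x) x 1 /\
   derive1 (fun s => \int[mu]_(x in `[a, s]) g x) x = g x}.
  by apply: ae_imp (FTC1 Iy lg) => x + ax; apply; rewrite /= lte_fin.
apply: ae_imp (ae_conj (ae_conj (ae_neq a) (ae_neq b)) H) => s [[sa sb] {}H].
rewrite in_itv/= => /andP[as_ sb'].
have {}as_ : a < s by rewrite lt_neqAle eq_sym sa.
have {}sb' : s < b by rewrite lt_neqAle sb.
have [D1 D2] := H as_.
have -> : f s = g s by rewrite /g patchE mem_set//= in_itv/= !ltW.
have : is_derive s 1 (fun s => \int[mu]_(x in `[a, s]) g x) (g s).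
  by split; [exact: D1|rewrite -derive1E; exact: D2].
apply: near_eq_is_derive.
near=> z; apply: eq_Rintegral => y; rewrite inE/= in_itv/= => /andP[ay yz].
rewrite /g patchE mem_set//= in_itv/= ay/= (le_trans yz)// ltW//.
by near: z; exact: lt_nbhsl.
Unshelve. all: by end_near. Qed.

(** The difference of [f] and the integral of [g] has derivative 0 almost everywhere, so the
    monotonicity lemma applies to it with both signs. *)
Lemma ac_FTC a b f g : absolutely_continuous a b f ->
  mu.-integrable `[a, b] (EFin \o g) ->
  {ae mu, forall s, s \in `[a, b] -> is_derive s 1 f (g s)} ->
  forall s, a <= s <= b -> f s = f a + \int[mu]_(x in `[a, s]) g x.
Proof.
move=> acf Ig df s /andP[as_ sb].
have acI := acS (lexx a) sb (int_ac Ig).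
have {}acf := acS (lexx a) sb acf.
have dI := int_ae_derive Ig.
set G := (fun s => _) in acI dI.
have Ga : G a = 0 by rewrite /G set_itv1 Rintegral_set1.
have H1 : f a - G a <= f s - G s.
  apply: (@ac_derive_ge0_le R a s (f \- G)) => //.
    apply: (@ac_dom a s 1 f G) => // x y _ _ _ /=; rewrite mul1r.
    by rewrite opprD addrACA (le_trans (ler_normD _ _))// -opprD normrN.
  apply: ae_imp (ae_conj df dI) => x [{}df {}dI] /=; rewrite in_itv/= => xas.
  have xab : x \in `[a, b] by rewrite in_itv/=; lra.
  exists 0 => //; rewrite -(subrr (g x)); apply: is_deriveB; [exact: df|exact: dI].
have H2 : G a - f a <= G s - f s.
  apply: (@ac_derive_ge0_le R a s (G \- f)) => //.
    apply: (@ac_dom a s 1 G f) => // x y _ _ _ /=; rewrite mul1r.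
    by rewrite opprD addrACA (le_trans (ler_normD _ _))// -opprD normrN.
  apply: ae_imp (ae_conj df dI) => x [{}df {}dI] /=; rewrite in_itv/= => xas.
  have xab : x \in `[a, b] by rewrite in_itv/=; lra.
  exists 0 => //; rewrite -(subrr (g x)); apply: is_deriveB; [exact: dI|exact: df].
by rewrite -/(G s); lra.
Qed.

End ac.

(** * Calculus of indefinite integrals *)

Section primitive.
Context {R : realType}.
Local Notation mu := (@lebesgue_measure R).
Implicit Types (a b : R) (f g h : R -> R).

Lemma integrable_cst_itv a b (C : R) : mu.-integrable `[a, b] (EFin \o cst C).
Proof.
apply: continuous_compact_integrable; first exact: segment_compact.
by apply: continuous_subspaceT => x; exact: cvg_cst.
Qed.

(** A Herglotz solution comes with a derivative almost everywhere but with no integrability of the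
    right-hand side, and this lemma supplies it. The truncations [G n] are bounded, and [f] minus
    the integral of [G n] has the nonnegative derivative [g - G n]; so [f b - f a] bounds all the
    integrals of the [G n], and monotone convergence concludes. *)
Lemma ac_integrable_lb a b C f g : absolutely_continuous a b f ->
  measurable_fun `[a, b] g -> (forall s, a <= s <= b -> - C <= g s) ->
  {ae mu, forall s, s \in `[a, b] -> is_derive s 1 f (g s)} ->
  mu.-integrable `[a, b] (EFin \o g).
Proof.
move=> acf mg gC df.
have [ba|ab] := ltP b a; first by rewrite set_itv_ge ?bnd_simp -?ltNge//; exact: integrable_set0.
wlog C0 : C gC / 0 <= C.
  move=> /(_ `|C|) W; apply: W => // s sab.
  by rewrite (le_trans _ (gC _ sab))// lerN2 ler_norm.
pose G n s := Num.min (g s) n%:R.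
have GC n s : a <= s <= b -> - C <= G n s.
  by move=> sab; rewrite le_min gC//= (@le_trans _ _ 0)// oppr_le0.
have mG n : measurable_fun `[a, b] (G n) by exact: measurable_minr.
have IG n : mu.-integrable `[a, b] (EFin \o G n).
  apply: measurable_bounded_integrable => //.
    by rewrite /= lebesgue_measure_itv/=; case: ifP => // _; rewrite -EFinD ltry.
  exact: mG.
  exists (C + n%:R); split; first exact: num_real.
  move=> M CM s sab /=; move: sab; rewrite /= in_itv/= => sab; rewrite ler_norml; apply/andP; split.
    by have := GC n s sab; have : 0 <= n%:R :> R by []; lra.
  by rewrite (@le_trans _ _ n%:R) ?ge_min ?lexx ?orbT//; lra.
have HG n : \int[mu]_(s in `[a, b]) G n s <= f b - f a.
  have acG := int_ac (IG n); have dG := int_ae_derive (IG n).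
  set Fn := (fun s => \int[mu]_(x in `[a, s]) _) in acG dG.
  have Fa : Fn a = 0 by rewrite /Fn set_itv1 Rintegral_set1.
  suff : f a - Fn a <= f b - Fn b by rewrite Fa -/(Fn b); lra.
  apply: (@ac_derive_ge0_le R a b (f \- Fn)) => //.
    apply: (@ac_dom _ a b 1 f Fn) => // x y _ _ _ /=; rewrite mul1r.
    by rewrite opprD addrACA (le_trans (ler_normD _ _))// -opprD normrN.
  apply: ae_imp (ae_conj df dG) => x [{}df {}dG] /= xab.
  exists (g x - G n x); first by rewrite subr_ge0 ge_min lexx.
  by apply: is_deriveB; [exact: df|exact: dG].
pose h n s := (G n s + C)%:E.
have h0 n s : `[a, b]%classic s -> (0 <= h n s)%E.
  by rewrite /= in_itv/= => sab; rewrite lee_fin -lerBlDr sub0r GC.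
have mh n : measurable_fun `[a, b] (h n).
  by apply/measurable_EFinP; apply: measurable_funD.
have ndh s : `[a, b]%classic s -> nondecreasing_seq (h ^~ s).
  move=> _ n m nm; rewrite lee_fin lerD2r le_min ge_min lexx/=.
  by rewrite ge_min ler_nat nm orbT.
have limh s : limn (h ^~ s) = (g s + C)%:E.
  apply: lim_near_cst => //; near=> n; rewrite /h /G.
  rewrite (min_idPl _)//; near: n; exact: nbhs_infty_ger.
have Igc : mu.-integrable `[a, b] (fun s => (g s + C)%:E).
  apply/integrableP; split; first by apply/measurable_EFinP; apply: measurable_funD.
  have -> : (\int[mu]_(s in `[a, b]) `|(g s + C)%:E| = \int[mu]_(s in `[a, b]) limn (h ^~ s))%E.
    apply: eq_integral => s; rewrite inE/= in_itv/= => sab; rewrite limh/= ger0_norm//.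
    by have := gC _ sab; lra.
  rewrite monotone_convergence//.
  apply: (@le_lt_trans _ _ (f b - f a + C * (b - a))%:E); last exact: ltry.
  apply: lime_le.
    apply: ereal_nondecreasing_is_cvgn => n m nm.
    by apply: ge0_le_integral => //; first [exact: mh|exact: h0|move=> s sab; exact: ndh].
  apply: nearW => n; rewrite /h.
  have IC := integrable_cst_itv a b C.
  have -> : (\int[mu]_(x in `[a, b]) (G n x + C)%:E)%E = (\int[mu]_(x in `[a, b]) (G n x + C))%:E.
    rewrite /Rintegral fineK//; apply: integrable_fin_num => //.
    by have := integrableD _ (IG n) IC; exact.
  rewrite lee_fin RintegralD//; apply: lerD; first exact: HG.
  rewrite Rintegral_cst//= lebesgue_measure_itv/= lte_fin.
  case: ltP => [_|ba]; first by rewrite -EFinB.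
  by rewrite mulr0 mulr_ge0// subr_ge0.
have IC := integrable_cst_itv a b C.
have -> : EFin \o g = ((fun s => (g s + C)%:E) \- (EFin \o cst C))%E.
  by apply/funext => s /=; rewrite -EFinB addrK.
exact: integrableB.
Unshelve. all: by end_near. Qed.

Definition primitive a b f g := mu.-integrable `[a, b] (EFin \o g) /\
  forall s, a <= s <= b -> f s = f a + \int[mu]_(x in `[a, s]) g x.

Lemma ac_primitive a b f g : absolutely_continuous a b f ->
  mu.-integrable `[a, b] (EFin \o g) ->
  {ae mu, forall s, s \in `[a, b] -> is_derive s 1 f (g s)} -> primitive a b f g.
Proof. by move=> acf Ig df; split => //; exact: ac_FTC. Qed.

Lemma primitive_incr a b f g x y : primitive a b f g -> a <= x -> x <= y -> y <= b ->
  f y - f x = \int[mu]_(s in `[x, y]) g s.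
Proof.
move=> [Ig H] ax xy yb; rewrite (H y) ?(H x); [|lra..].
rewrite -(@Rintegral_itv_sub _ a)//; first lra.
exact: integrable_sub_itv Ig.
Qed.

Lemma primitive_ac a b f g : primitive a b f g -> absolutely_continuous a b f.
Proof.
move=> H; have [Ig Hf] := H; apply: (ac_dom (C := 1)); [|exact: (int_ac Ig)..].
move=> x y ax xy yb; rewrite (primitive_incr H)// mul1r.
by rewrite Rintegral_itv_sub//; [rewrite lerDl|exact: integrable_sub_itv Ig].
Qed.

Lemma primitive_continuous a b f g : primitive a b f g ->
  {within `[a, b], continuous f}.
Proof. by move=> /primitive_ac/ac_continuous. Qed.

Lemma primitive_ae a b f g : primitive a b f g ->
  {ae mu, forall s, s \in `[a, b] -> is_derive s 1 f (g s)}.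
Proof.
move=> [Ig H].
apply: ae_imp (ae_conj (ae_conj (ae_neq a) (ae_neq b)) (int_ae_derive Ig)) => s [[sa sb] {}I].
move=> sab; have {I} := I sab; move: sab; rewrite in_itv/= => /andP[as_ sb'] I.
have {}as_ : a < s by rewrite lt_neqAle eq_sym sa.
have {}sb' : s < b by rewrite lt_neqAle sb.
have : is_derive s 1 (cst (f a) \+ (fun s => \int[mu]_(x in `[a, s]) g x)) (0 + g s).
  exact: is_deriveD.
rewrite add0r; apply: near_eq_is_derive.
near=> z; rewrite /= [RHS]H//.
apply/andP; split; apply/ltW; near: z; [exact: lt_nbhsr|exact: lt_nbhsl].
Unshelve. all: by end_near. Qed.

Lemma primitive_ae_unique a b f g1 g2 : primitive a b f g1 -> primitive a b f g2 ->
  {ae mu, forall s, s \in `[a, b] -> g1 s = g2 s}.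
Proof.
move=> /primitive_ae H1 /primitive_ae H2; apply: ae_imp (ae_conj H1 H2) => s [h1 h2] sab.
by have [_ <-] := h1 sab; have [_ <-] := h2 sab.
Qed.

Lemma primitive_add a b f1 g1 f2 g2 : primitive a b f1 g1 -> primitive a b f2 g2 ->
  primitive a b (f1 \+ f2) (g1 \+ g2).
Proof.
move=> H1 H2; apply: ac_primitive.
- apply: (ac_dom (C := 1) _ (primitive_ac H1) (primitive_ac H2)) => x y _ _ _ /=.
  by rewrite mul1r opprD addrACA ler_normD.
- by have := integrableD _ H1.1 H2.1; exact.
- apply: ae_imp (ae_conj (primitive_ae H1) (primitive_ae H2)) => s [h1 h2] sab.
  by apply: is_deriveD; [exact: h1|exact: h2].
Qed.

Lemma primitive_sub a b f1 g1 f2 g2 : primitive a b f1 g1 -> primitive a b f2 g2 ->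
  primitive a b (f1 \- f2) (g1 \- g2).
Proof.
move=> H1 H2; apply: ac_primitive.
- apply: (ac_dom (C := 1) _ (primitive_ac H1) (primitive_ac H2)) => x y _ _ _ /=.
  have -> : f1 y - f2 y - (f1 x - f2 x) = f1 y - f1 x - (f2 y - f2 x) by ring.
  by rewrite mul1r ler_normB.
- by have := integrableB _ H1.1 H2.1; exact.
- apply: ae_imp (ae_conj (primitive_ae H1) (primitive_ae H2)) => s [h1 h2] sab.
  by apply: is_deriveB; [exact: h1|exact: h2].
Qed.

Lemma primitive_mul a b f1 g1 f2 g2 : primitive a b f1 g1 -> primitive a b f2 g2 ->
  primitive a b (f1 \* f2) (g1 \* f2 \+ g2 \* f1).
Proof.
move=> H1 H2.
have [C1 C10 HC1] := continuous_within_bounded (primitive_continuous H1).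
have [C2 C20 HC2] := continuous_within_bounded (primitive_continuous H2).
apply: ac_primitive.
- apply: (ac_dom (C := C1 + C2) _ (primitive_ac H1) (primitive_ac H2)) => x y ax xy yb /=.
  have -> : f1 y * f2 y - f1 x * f2 x = (f1 y - f1 x) * f2 y + f1 x * (f2 y - f2 x) by ring.
  rewrite (le_trans (ler_normD _ _))// !normrM.
  have := HC1 x; have := HC2 y; rewrite ax (le_trans ax xy) yb (le_trans xy yb) => /(_ isT) h2 /(_ isT) h1.
  have : `|f1 y - f1 x| * `|f2 y| <= C2 * `|f1 y - f1 x| by rewrite mulrC ler_wpM2r.
  have : `|f1 x| * `|f2 y - f2 x| <= C1 * `|f2 y - f2 x| by rewrite ler_wpM2r.
  have : 0 <= C1 * `|f1 y - f1 x| by rewrite mulr_ge0.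
  have : 0 <= C2 * `|f2 y - f2 x| by rewrite mulr_ge0.
  lra.
- have := integrableD _ (integrable_mul_continuous H1.1 (primitive_continuous H2))
    (integrable_mul_continuous H2.1 (primitive_continuous H1)); exact.
- apply: ae_imp (ae_conj (primitive_ae H1) (primitive_ae H2)) => s [h1 h2] sab.
  have := is_deriveM (h1 sab) (h2 sab); rewrite addrC.
  by rewrite -![_ *: _]/(_ * _) [f2 s * _]mulrC [f1 s * _]mulrC.
Qed.

Lemma primitive_exp a b f g : primitive a b f g ->
  primitive a b (expR \o f) (g \* (expR \o f)).
Proof.
move=> H; have [C C0 HC] := continuous_within_bounded (primitive_continuous H).
have acE : absolutely_continuous a b (expR \o f).
  apply: (ac_dom (C := expR C) _ (primitive_ac H) (primitive_ac H)) => x y ax xy yb /=.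
  have fx : f x <= C by apply: (le_trans (ler_norm _)); apply: HC; lra.
  have fy : f y <= C by apply: (le_trans (ler_norm _)); apply: HC; lra.
  (* The exponential is Lipschitz with constant [expR C] below [C], by
     [1 - expR (u - v) <= v - u]. *)
  have key u v : u <= v -> v <= C -> `|expR v - expR u| <= expR C * `|v - u|.
    move=> uv vC; rewrite !ger0_norm ?subr_ge0 ?ler_expR//.
    have -> : expR v - expR u = expR v * (1 - expR (u - v)).
      by rewrite mulrBr mulr1 -expRD; congr (_ - expR _); ring.
    apply: (@le_trans _ _ (expR v * (v - u))).
      by rewrite ler_pM2l ?expR_gt0//; have := expR_ge1Dx (u - v); lra.
    by rewrite ler_wpM2r ?subr_ge0// ler_expR.
  apply: (@le_trans _ _ (expR C * `|f y - f x|)).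
    have [h|/ltW h] := leP (f x) (f y); first exact: key.
    by rewrite distrC [X in _ * X]distrC; exact: key.
  by rewrite ler_wpM2l ?expR_ge0// lerDl.
apply: ac_primitive => //.
- exact: integrable_mul_continuous H.1 (ac_continuous acE).
- apply: ae_imp (primitive_ae H) => s h sab /=.
  by rewrite mulrC; apply: is_derive1_comp; exact: h.
Qed.

Lemma primitive_ext a b f1 f2 g1 g2 : (forall s, a <= s <= b -> f1 s = f2 s) ->
  (forall s, a <= s <= b -> g1 s = g2 s) ->
  primitive a b f1 g1 -> primitive a b f2 g2.
Proof.
move=> ef eg [I1 H1]; split.
  by apply: eq_integrable I1 => // x; rewrite inE/= in_itv/= => xab; rewrite eg.
move=> s sab; rewrite -!ef//; last lra.
rewrite H1//; congr (_ + _); apply: eq_Rintegral => x; rewrite inE/= in_itv/= => xs.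
by apply: eg; lra.
Qed.

Lemma int_primitive a b g : mu.-integrable `[a, b] (EFin \o g) ->
  primitive a b (fun s => \int[mu]_(x in `[a, s]) g x) g.
Proof.
by move=> Ig; split => // s _; rewrite set_itv1 Rintegral_set1 add0r.
Qed.

Lemma primitive_cst a b k : primitive a b (cst k) (cst 0).
Proof.
split; last by move=> s _; rewrite Rintegral_cst// mul0r addr0.
exact: integrable_cst_itv.
Qed.

Lemma derive_primitive a b f g : {within `[a, b], continuous g} ->
  (forall s, a <= s <= b -> is_derive s 1 f (g s)) -> primitive a b f g.
Proof.
move=> cg df; have [C C0 HC] := continuous_within_bounded cg.
have cf s : a <= s <= b -> {for s, continuous f}.
  by move=> sab; apply/differentiable_continuous/derivable1_diffP; have [] := df s sab.
apply: ac_primitive.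
- apply: (@lipschitz_ac _ _ _ C) => x y ax xy yb.
  have [<-|xy'] := eqVneq x y; first by rewrite !subrr normr0 mulr0.
  have {}xy' : x < y by rewrite lt_neqAle xy'.
  have [|||c cxy ->] := @MVT R f g x y _ _ _.
  - exact: xy'.
  - by move=> c; rewrite in_itv/= => cxy; apply: df; lra.
  - apply: continuous_in_subspaceT => c; rewrite inE/= in_itv/= => cxy.
    by apply: cf; lra.
  rewrite normrM [`|y - x|]ger0_norm ?subr_ge0//.
  rewrite ler_wpM2r ?subr_ge0// HC//; move: cxy; rewrite in_itv/=; lra.
- by apply: continuous_compact_integrable => //; exact: segment_compact.
- by apply: aeW => s; rewrite in_itv/=; exact: df.
Qed.

End primitive.

(** * Weak derivatives *)

Section weak_derivative.
Context {R : realType}.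
Local Notation mu := (@lebesgue_measure R).
Implicit Types (a b : R) (f g h phi : R -> R).

Lemma test_function_derive a b phi : test_function a b phi ->
  continuous (derive1 phi) /\ forall s : R, is_derive s 1 phi (derive1 phi s).
Proof.
move=> [[dphi cphi] _]; split.
  have -> : derive1 phi = fun x => 'D_1 phi x by apply/funext => x; rewrite derive1E.
  exact: cphi.
move=> s; split; last by rewrite derive1E.
exact/derivable1_diffP.
Qed.

Lemma test_function_bounds a b phi : test_function a b phi -> phi a = 0 /\ phi b = 0.
Proof.
move=> [_ sub]; split; apply: contrapT => /eqP h.
  have /sub : closure [set s | phi s != 0] a by apply: subset_closure.
  by rewrite /= in_itv/= ltxx.
have /sub : closure [set s | phi s != 0] b by apply: subset_closure.
by rewrite /= in_itv/= ltxx andbF.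
Qed.

Lemma primitive_parts a b f g phi : a <= b -> primitive a b f g ->
  test_function a b phi ->
  \int[mu]_(s in `[a, b]) (f s * derive1 phi s) =
    - \int[mu]_(s in `[a, b]) (g s * phi s).
Proof.
move=> ab H tphi; have [cphi dphi] := test_function_derive tphi.
have [pa pb] := test_function_bounds tphi.
have Hphi : primitive a b phi (derive1 phi).
  by apply: derive_primitive => //; exact: continuous_subspaceT.
have := primitive_incr (primitive_mul H Hphi) (lexx a) ab (lexx b).
rewrite /= pa pb !mulr0 subrr RintegralD//=; last 2 first.
  exact: integrable_mul_continuous H.1 (primitive_continuous Hphi).
  exact: integrable_mul_continuous Hphi.1 (primitive_continuous H).
move=> /esym/eqP; rewrite addrC addr_eq0 => /eqP <-.
by apply: eq_Rintegral => s _; rewrite mulrC.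
Qed.

Let pos (z : R) := Num.max z 0.

Let pos_continuous : continuous pos.
Proof. by move=> x; apply: continuous_max; [exact: cvg_id|exact: cvg_cst]. Qed.

Let is_derive_pos2 (z : R) : is_derive z 1 (fun z => pos z ^+ 2) (2 * pos z).
Proof.
have [z0|z0|z0] := ltgtP z 0.
- rewrite /pos (max_idPr (ltW z0)) mulr0.
  have : is_derive z 1 (cst (0 : R)) 0 by exact: is_derive_cst.
  apply: near_eq_is_derive.
  near=> y; rewrite (max_idPr _) ?expr0n//=; apply/ltW; near: y; exact: lt_nbhsl.
- rewrite /pos (max_idPl (ltW z0)).
  have -> : 2 * z = z *: 1 + z *: 1 by rewrite -[_ *: _]/(_ * _) mulr1 mulr_natl mulr2n.
  have := is_deriveM (is_derive_id z 1) (is_derive_id z 1).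
  apply: near_eq_is_derive.
  near=> y; rewrite (max_idPl _); first by rewrite expr2.
  by apply/ltW; near: y; exact: lt_nbhsr.
- rewrite z0; apply/is_derive1_caratheodory; exists pos; split.
  + move=> y; rewrite /pos maxxx expr0n subr0 subr0; case: leP => y0; rewrite ?mul0r ?expr0n//.
  + exact: pos_continuous.
  + by rewrite /pos maxxx mulr0.
Unshelve. all: by end_near. Qed.

(** The second difference of the C^1 function [pos ^ 2]: it rises from 0 to [2 k^2] between 0 and
    [2 k] and is constant outside. Its derivative [tent] is the triangle of base [2 k] and height
    [2 k]. The difference of two translates of [step] vanishes far away on both sides, which makes
    it a test function. *)
Let step (k z : R) := pos z ^+ 2 - 2 * pos (z - k) ^+ 2 + pos (z - k *+ 2) ^+ 2.
Let tent (k z : R) := 2 * (pos z - 2 * pos (z - k) + pos (z - k *+ 2)).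

Let tent_continuous (k p : R) : continuous (fun z => tent k (z - p)).
Proof.
have c1 (r : R) : continuous (fun z => pos (z - r)).
  move=> x; apply: (@continuous_comp _ _ _ (fun z => z - r) pos); last exact: pos_continuous.
  by apply: cvgB; [exact: cvg_id|exact: cvg_cst].
have -> : (fun z => tent k (z - p)) =
    (fun z => 2 * (pos (z - p) - 2 * pos (z - (p + k)) + pos (z - (p + k *+ 2)))).
  by apply/funext => z; rewrite /tent !opprD !addrA.
move=> x; apply: cvgM; first exact: cvg_cst.
apply: cvgD; last exact: c1.
apply: cvgB; first exact: c1.
by apply: cvgM; [exact: cvg_cst|exact: c1].
Qed.

Let is_derive_step (k p z : R) : is_derive z 1 (fun z => step k (z - p)) (tent k (z - p)).
Proof.
have d1 (r : R) : is_derive z 1 (fun z => pos (z - r) ^+ 2) (2 * pos (z - r)).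
  have D : is_derive z 1 (fun z : R => z - r) 1.
    by rewrite -[X in is_derive _ _ _ X](subr0 1); apply: is_deriveB; exact: is_derive_cst.
  have := @is_derive1_comp R (fun z => pos z ^+ 2) (fun z => z - r) z _ _ (is_derive_pos2 (z - r)) D.
  by rewrite mulr1.
have -> : (fun z => step k (z - p)) =
    (fun z => pos (z - p) ^+ 2) - (cst 2 * (fun z => pos (z - (p + k)) ^+ 2)) + (fun z => pos (z - (p + k *+ 2)) ^+ 2).
  by apply/funext => y; rewrite /step !fctE !opprD !addrA.
have := is_deriveD (is_deriveB (d1 p) (is_deriveM (is_derive_cst (2 : R) z 1) (d1 (p + k)))) (d1 (p + k *+ 2)).
move=> /is_derive_eq; apply.
rewrite /tent -![_ *: _]/(_ * _) !opprD !addrA.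
ring.
Qed.

Let tent_ge0 (k z : R) : 0 < k -> 0 <= tent k z.
Proof.
move=> k0; rewrite /tent /pos mulr2n.
have [] := leP z 0; have [] := leP (z - k) 0; have [] := leP (z - (k + k)) 0; lra.
Qed.

Let tent_out (k z : R) : 0 < k -> z <= 0 \/ k *+ 2 <= z -> tent k z = 0.
Proof.
move=> k0; rewrite /tent /pos mulr2n.
have [] := leP z 0; have [] := leP (z - k) 0; have [] := leP (z - (k + k)) 0; move=> ? ? ? []; lra.
Qed.

Let step_le (k z : R) : 0 < k -> z <= 0 -> step k z = 0.
Proof.
move=> k0; rewrite /step /pos mulr2n.
have [] := leP z 0; have [] := leP (z - k) 0; have [] := leP (z - (k + k)) 0; move=> ? ? ? ?; lra.
Qed.

Let step_ge (k z : R) : 0 < k -> k *+ 2 <= z -> step k z = 2 * k ^+ 2.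
Proof.
move=> k0 kz; rewrite /step /pos !(max_idPl _).
- by rewrite mulr2n; ring.
- lra.
- lra.
- lra.
Qed.

Let classC1 phi g : (forall z : R, is_derive z 1 phi (g z)) -> continuous g -> classC 1 phi.
Proof.
move=> d cg; have dphi x : differentiable phi x by apply/derivable1_diffP; have [] := d x.
split => // v; have -> : (fun x => 'D_v phi x) = (fun x => v * g x).
  apply/funext => x; rewrite deriveE//; have [_ <-] := d x; rewrite deriveE//.
  by rewrite -{1}[v]mulr1 -[v * 1]/(v *: 1) linearZ.
by move=> x; apply: cvgM; [exact: cvg_cst|exact: cg].
Qed.

Let step_test a b p r k : a < p -> p < r -> 0 < k -> r + k *+ 2 < b ->
  test_function a b (fun z => step k (z - p) - step k (z - r)).
Proof.
move=> ap pr k0 rb; split.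
  apply: (@classC1 _ (fun z => tent k (z - p) - tent k (z - r))).
    by move=> z; apply: is_deriveB; exact: is_derive_step.
  by move=> z; apply: cvgB; exact: tent_continuous.
apply: (@subset_trans _ `[p, r + k *+ 2]); last first.
  by move=> z /=; rewrite !in_itv/=; lra.
have -> : `[p, r + k *+ 2]%classic = closure `[p, r + k *+ 2] by rewrite -closure_id; exact: interval_closed.
apply: closure_subset => z /=; rewrite in_itv/= => h.
apply: contraNT h => h; have [zp|zr] : z <= p \/ r + k *+ 2 <= z.
    by move: h; rewrite negb_and -!ltNge => /orP[] h; [left|right]; exact: ltW.
  by rewrite !step_le ?subrr//; lra.
by rewrite !step_ge ?subrr//; lra.
Qed.

(** The tent is nonnegative, has mass [2 k^2] and vanishes outside [[p, p + 2 k]], so it averages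
    [h] near [p]. *)
Let tent_mean a b h p k e : {within `[a, b], continuous h} -> a < p -> 0 < k ->
  p + k *+ 2 < b -> (forall z, p <= z -> z <= p + k *+ 2 -> `|h z - h p| <= e) ->
  `|\int[mu]_(z in `[a, b]) (h z * tent k (z - p)) - h p * (2 * k ^+ 2)| <= e * (2 * k ^+ 2).
Proof.
move=> ch ap k0 pb H.
have Ht : primitive a b (fun z => step k (z - p)) (fun z => tent k (z - p)).
  apply: derive_primitive; first exact/continuous_subspaceT/tent_continuous.
  by move=> z _; exact: is_derive_step.
have ab : a <= b by lra.
have It : \int[mu]_(z in `[a, b]) (tent k (z - p)) = 2 * k ^+ 2.
  rewrite -(primitive_incr Ht) ?lexx// step_ge//; last lra.
  by rewrite step_le ?subr0//; lra.
have Iht : mu.-integrable `[a, b] (EFin \o (h \* (fun z => tent k (z - p)))).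
  apply: integrable_mul_continuous; last exact: (ac_continuous (int_ac _)) || exact/continuous_subspaceT/tent_continuous.
  by apply: continuous_compact_integrable => //; exact: segment_compact.
have IhT (c : R) : mu.-integrable `[a, b] (EFin \o (fun z => c * tent k (z - p))).
  by have := integrableZl _ c Ht.1; exact.
have Ic (c : R) : \int[mu]_(z in `[a, b]) (c * tent k (z - p)) = c * (2 * k ^+ 2).
  by rewrite -It RintegralZl//; exact: Ht.1.
rewrite -!Ic -RintegralB//.
apply: le_trans (le_normr_Rintegral _ _) _ => //.
  by have := integrableB _ Iht (IhT (h p)); exact.
apply: le_Rintegral => //.
  by have := integrable_norm (integrableB _ Iht (IhT (h p))); exact.
move=> z _; rewrite -mulrBl normrM (ger0_norm (tent_ge0 _ _))//.
have [zp|zp] := leP z p; first by rewrite tent_out ?mulr0//; left; lra.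
have [zr|zr] := leP (p + k *+ 2) z; first by rewrite tent_out ?mulr0//; right; lra.
by rewrite ler_wpM2r ?tent_ge0// H// ltW.
Qed.

(* Testing against the difference of two narrow tents of equal mass. *)
Lemma du_bois_reymond a b h : a < b -> {within `[a, b], continuous h} ->
  (forall phi, test_function a b phi ->
     \int[mu]_(s in `[a, b]) (h s * derive1 phi s) = 0) ->
  forall s, a <= s <= b -> h s = h a.
Proof.
move=> ab ch H.
have inside p r : a < p -> p < r -> r < b -> h p = h r.
  move=> ap pr rb; apply/eqP; rewrite -subr_eq0 -normr_le0; apply/ler_addgt0Pr => e e0.
  rewrite add0r.
  have near_h s : a < s -> s < b -> exists2 d, 0 < d &
      forall k, 0 < k -> k *+ 2 < d -> forall z, s <= z -> z <= s + k *+ 2 -> `|h z - h s| <= e / 2.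
    move=> as_ sb; have e2 : 0 < e / 2 by rewrite divr_gt0.
    have : {for s, continuous h}.
      by move/(continuous_within_itvP _ ab) : ch => [+ _ _]; apply; rewrite in_itv/= as_.
    move=> /cvgrPdist_lt/(_ _ e2)[d /= d0 Hd].
    exists d => // k k0 kd z sz zs; rewrite distrC; apply/ltW/Hd.
    by rewrite /= ltr_distl; lra.
  have [d1 d10 H1] := near_h p ap (lt_trans pr rb).
  have [d2 d20 H2] := near_h r (lt_trans ap pr) rb.
  (* Both tents have width [2 k]; the factor 4 leaves room for the strict inequalities that keep
     them inside []a, b[] and inside the neighbourhoods where [h] is within [e / 2] of [h p] and of
     [h r]. *)
  pose k := Num.min (Num.min d1 d2) (Num.min (b - r) (r - p)) / 4.
  have k0 : 0 < k by rewrite divr_gt0// !lt_min d10 d20; lra.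
  have k4 : k * 4 = Num.min (Num.min d1 d2) (Num.min (b - r) (r - p)) by rewrite divfK.
  have kd1 : k * 4 <= d1 by rewrite k4 !ge_min lexx.
  have kd2 : k * 4 <= d2 by rewrite k4 !ge_min lexx !orbT.
  have kbr : k * 4 <= b - r by rewrite k4 !ge_min lexx !orbT.
  have k2 : k *+ 2 = 2 * k by rewrite mulr_natl.
  have M1 := tent_mean ch ap k0 _ (H1 k k0 _).
  have M2 := tent_mean ch (lt_trans ap pr) k0 _ (H2 k k0 _).
  have {M1} M1 := M1 ltac:(lra) ltac:(lra).
  have {M2} M2 := M2 ltac:(lra) ltac:(lra).
  have tphi : test_function a b (fun z => step k (z - p) - step k (z - r)).
    by apply: step_test => //; lra.
  have It q : mu.-integrable `[a, b] (EFin \o (fun z => h z * tent k (z - q))).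
    apply: integrable_mul_continuous; last exact/continuous_subspaceT/tent_continuous.
    by apply: continuous_compact_integrable => //; exact: segment_compact.
  have := H _ tphi.
  have -> : \int[mu]_(z in `[a, b]) (h z * derive1 (fun z => step k (z - p) - step k (z - r)) z) =
      \int[mu]_(z in `[a, b]) (h z * tent k (z - p) - h z * tent k (z - r)).
    apply: eq_Rintegral => z _; rewrite -mulrBr; congr (_ * _); rewrite derive1E.
    by have [_ ->] : is_derive z 1 (fun z => step k (z - p) - step k (z - r))
      (tent k (z - p) - tent k (z - r)) by apply: is_deriveB; exact: is_derive_step.
  rewrite RintegralB//.
  move: M1 M2; set A := Rintegral _ _ _; set B := Rintegral _ _ _.
  rewrite !ler_norml => /andP[A1 A2] /andP[B1 B2] AB.
  have kk : 0 < 2 * k ^+ 2 by rewrite mulr_gt0// exprn_gt0.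
  apply/andP; split.
    by rewrite -(ler_pM2r kk); lra.
  by rewrite -(ler_pM2r kk); lra.
have half : a < (a + b) / 2 < b by lra.
pose c := h ((a + b) / 2).
have hc s : a < s < b -> h s = c.
  move=> /andP[as_ sb]; have [s1|s1|->//] := ltgtP s ((a + b) / 2); rewrite /c.
    by apply: inside => //; lra.
  by rewrite -(inside ((a + b) / 2) s)//; lra.
(* Test functions only see the open interval; the values at the ends are recovered as one-sided
   limits. *)
move/(continuous_within_itvP _ ab) : ch => [_ ca cb].
have ha : h a = c.
  have na : h z @[z --> a^'+] --> c.
    apply: cvg_near_cst.
    by near=> z; apply: hc; apply/andP; split; near: z; [exact: nbhs_right_gt|exact: nbhs_right_lt].
  by rewrite -(cvg_lim (@Rhausdorff R) ca) (cvg_lim (@Rhausdorff R) na).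
have hb : h b = c.
  have nb : h z @[z --> b^'-] --> c.
    apply: cvg_near_cst.
    by near=> z; apply: hc; apply/andP; split; near: z; [exact: nbhs_left_gt|exact: nbhs_left_lt].
  by rewrite -(cvg_lim (@Rhausdorff R) cb) (cvg_lim (@Rhausdorff R) nb).
move=> s /andP[as_ sb]; rewrite ha.
have [->//|sa] := eqVneq s a; have [->//|sb'] := eqVneq s b.
by apply: hc; rewrite !lt_neqAle eq_sym sa as_ sb' sb.
Unshelve. all: by end_near. Qed.

(** By integration by parts the integral [G] of [g] satisfies the same identity as [f], so [f - G]
    has weak derivative 0 and is constant. *)
Lemma weak_derivative_primitive a b f g : a < b -> {within `[a, b], continuous f} ->
  mu.-integrable `[a, b] (EFin \o g) ->
  (forall phi, test_function a b phi ->
    \int[mu]_(s in `[a, b]) (f s * derive1 phi s) =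
    - \int[mu]_(s in `[a, b]) (g s * phi s)) ->
  primitive a b f g.
Proof.
move=> ab cf Ig H.
have HG := int_primitive Ig; set G := (fun s => _) in HG.
have cG := primitive_continuous HG.
have ch : {within `[a, b], continuous (f \- G)}.
  by move=> x; apply: cvgB; [exact: cf|exact: cG].
have hc : forall s, a <= s <= b -> (f \- G) s = (f \- G) a.
  apply: (du_bois_reymond ab ch) => phi tphi.
  have [cphi _] := test_function_derive tphi.
  have cphi' : {within `[a, b], continuous (derive1 phi)} by exact: continuous_subspaceT.
  have Ic (u : R -> R) : {within `[a, b], continuous u} -> mu.-integrable `[a, b] (EFin \o (fun s => u s * derive1 phi s)).
    move=> cu; apply: integrable_mul_continuous => //.
    by apply: continuous_compact_integrable => //; exact: segment_compact.
  under eq_Rintegral do rewrite mulrBl.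
  rewrite RintegralB//; [|exact: Ic|exact: Ic].
  by rewrite H// (primitive_parts (ltW ab) HG tphi) subrr.
split => // s sab; have /= := hc s sab.
rewrite {2}/G set_itv1 Rintegral_set1 subr0 => <-.
by rewrite /G subrK.
Qed.

End weak_derivative.

Section real_integral.
Context {R : realType}.
Local Notation mu := (@lebesgue_measure R).
Implicit Types (a b : R) (f g h : R -> R).

Lemma integrable_dominated (D : set R) f g : measurable D -> measurable_fun D f ->
  mu.-integrable D (EFin \o g) -> (forall x, D x -> `|f x| <= g x) ->
  mu.-integrable D (EFin \o f).
Proof.
move=> mD mf Ig fg; apply: le_integrable Ig => //; first exact/measurable_EFinP.
by move=> x Dx /=; rewrite lee_fin (le_trans (fg _ Dx))// ler_norm.
Qed.

Lemma norm_Rintegral_le (D : set R) f g : measurable D ->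
  mu.-integrable D (EFin \o f) -> mu.-integrable D (EFin \o g) ->
  (forall x, D x -> `|f x| <= g x) -> `|\int[mu]_(x in D) f x| <= \int[mu]_(x in D) g x.
Proof.
move=> mD If Ig fg; apply: (@le_trans _ _ (\int[mu]_(x in D) `|f x|)); first exact: le_normr_Rintegral.
by apply: le_Rintegral => //; exact: integrable_norm If.
Qed.

Lemma measurable_inv : measurable_fun setT (fun z : R => z^-1).
Proof.
have -> : [set: R] = [set 0] `|` [set z | z != 0].
  by apply/seteqP; split => // z _ /=; case: eqVneq => ?; [left|right].
have oN : open [set z : R | z != 0].
  have -> : [set z : R | z != 0] = ~` [set 0] by apply/seteqP; split => z /= /eqP.
  by apply: closed_openC; rewrite -set_itv1; exact: interval_closed.
apply/measurable_funU => //; first exact: open_measurable.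
split; first exact: measurable_fun_set1.
apply: open_continuous_measurable_fun => // z; rewrite inE/= => z0.
exact: inv_continuous.
Qed.

End real_integral.

(** * Measurability along curves, and W^{1,1} curves as primitives *)

Section vector_curves.
Context {R : realType} {n : nat}.
Local Notation mu := (@lebesgue_measure R).
Local Notation V := 'rV[R]_n.

Lemma filter_forall_ord T (F : set_system T) m (P : 'I_m -> set T) : Filter F ->
  (forall i, F (P i)) -> F [set x | forall i, P i x].
Proof.
move=> FF H.
suff K (k : nat) : F [set x | forall i : 'I_m, (i < k)%N -> P i x].
  by apply: filterS (K m) => x /= Hx i; apply: Hx.
elim: k => [|k IH]; first by apply: filterS filterT => x _ i.
have [km|km] := ltnP k m.
  apply: filterS (filterI IH (H (Ordinal km))) => x [/= Hx Px] i.
  rewrite ltnS leq_eqVlt => /orP[/eqP ik|]; last exact: Hx.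
  by have -> : i = Ordinal km by exact: val_inj.
by apply: filterS IH => x /= Hx i _; apply: Hx; exact: leq_trans (ltn_ord i) km.
Qed.

Lemma measurable_forall_ord (D : set R) m (P : 'I_m -> set R) : measurable D ->
  (forall i, measurable (D `&` P i)) -> measurable (D `&` [set x | forall i, P i x]).
Proof.
move=> mD mP.
have -> : D `&` [set x | forall i, P i x] =
    \bigcap_k (if insub k is Some i then D `&` P i else D).
  apply/seteqP; split => [x [Dx Px] k _|x Hx].
    by case: insubP => // i _ _; split.
  have Dx : D x by have := Hx m I; rewrite insubN ?ltnn.
  by split => // i; have := Hx i I; rewrite valK => -[].
by apply: bigcapT_measurable => k; case: insubP.
Qed.

(** Measurability is only assumed coordinate by coordinate. The open set [O] is the union of the
    countably many rational balls that it contains, and for the sup norm the preimage of a ball is a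
    finite intersection of conditions on single coordinates. *)
Lemma measurable_fun_continuous3 (D : set R) (G : V * R * V -> R)
  (x v : R -> V) (w : R -> R) : measurable D -> continuous G ->
  (forall i, measurable_fun D (fun s => x s 0 i)) -> measurable_fun D w ->
  (forall i, measurable_fun D (fun s => v s 0 i)) ->
  measurable_fun D (fun s => G (x s, w s, v s)).
Proof.
move=> mD cG mx mw mv; apply: (measurability _ (RGenOpens.measurableE R)).
move=> _ [_ [a [b ->] <-]].
pose O := G @^-1` `]a, b[.
have oO : open O by apply: open_comp; [move=> ? _; exact: cG|exact: interval_open].
pose Q : countType := ('rV[rat]_n * rat * 'rV[rat]_n * nat)%type.
pose ctr (c : Q) : V * R * V :=
  (map_mx ratr c.1.1.1, ratr c.1.1.2, map_mx ratr c.1.2).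
pose B (c : Q) := ball (ctr c) (c.2.+1%:R^-1 : R).
have mball (u : R -> R) (q e : R) : measurable_fun D u ->
    measurable (D `&` [set s | ball q e (u s)]).
  move=> mu'; have -> : [set s | ball q e (u s)] = u @^-1` `]q - e, q + e[.
    by apply/seteqP; split => s; rewrite /ball/= in_itv/= distrC ltr_distl.
  exact: mu'.
have mrow (y : R -> V) (q : V) (e : R) : 0 < e ->
    (forall i, measurable_fun D (fun s => y s 0 i)) ->
    measurable (D `&` [set s | ball q e (y s)]).
  move=> e0 my; have -> : [set s | ball q e (y s)] = [set s | forall i, ball (q 0 i) e (y s 0 i)].
    apply/seteqP; split => s /= => [[_ h] i|h]; first exact: h.
    by split => // i j; rewrite (ord1 i).
  by apply: measurable_forall_ord => // i; exact: mball.
have mB c : measurable (D `&` [set s | B c (x s, w s, v s)]).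
  have e0 : 0 < (c.2.+1%:R^-1 : R) by rewrite invr_gt0.
  have := measurableI _ _ (measurableI _ _ (mrow x (ctr c).1.1 _ e0 mx) (mball w (ctr c).1.2 (c.2.+1%:R^-1) mw)) (mrow v (ctr c).2 _ e0 mv).
  congr (measurable _); apply/seteqP; split => s /=.
    by move=> [[[Ds h1] [_ h2]] [_ h3]]; split => //; split.
  by move=> [Ds [[h1 h2] h3]].
have -> : D `&` (fun s => G (x s, w s, v s)) @^-1` `]a, b[ =
    \bigcup_k (if unpickle k is Some c then
      if pselect (B c `<=` O) then D `&` [set s | B c (x s, w s, v s)] else set0
      else set0).
  apply/seteqP; split => [s [Ds Os]|s [k _]]; last first.
    case: unpickle => // c; case: pselect => // BO [Ds Bs]; split => //.
    exact: (BO _ Bs).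
  have /nbhs_ballP[e /= e0 He] : nbhs (x s, w s, v s) O.
    exact: open_nbhs_nbhs.
  (* With radius below [e / 2], a ball whose rational centre is within that radius of the point
     contains the point and stays inside the [e]-ball around it. *)
  have [k hk] : exists k, (k.+1%:R^-1 : R) < e / 2.
    have e2 : 0 < e / 2 by rewrite divr_gt0.
    by have [k _ hk] := near_infty_natSinv_lt (PosNum e2); exists k; apply: (hk k) => /=.
  pose r : R := k.+1%:R^-1; have r0 : 0 < r by rewrite invr_gt0.
  have approx (y : R) : exists q : rat, ball (ratr q : R) r y.
    have [|q] := @rat_in_itvoo R (y - r) (y + r); first by lra.
    by rewrite in_itv/= => h; exists q; rewrite /ball/= ltr_distl; lra.
  have arow (y : V) : exists q : 'rV[rat]_n, ball (map_mx ratr q : V) r y.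
    have [q Hq] := choice (fun i => approx (y 0 i)).
    by exists (\row_i q i); split => // i j; rewrite !mxE (ord1 i).
  have [q1 H1] := arow (x s); have [q2 H2] := approx (w s); have [q3 H3] := arow (v s).
  pose c : Q := (q1, q2, q3, k).
  have Bc : B c (x s, w s, v s) by split.
  have BO : B c `<=` O.
    move=> z Bz; apply: He; apply: (@le_ball _ _ _ (r + r)); first by rewrite -/r in hk; lra.
    by apply: ball_triangle Bz; exact: ball_sym.
  exists (pickle c); first exact: I.
  rewrite pickleK; case: pselect => [h|/(_ BO)[]].
  by split; [exact: Ds|exact: Bc].
apply: bigcupT_measurable => k; case: unpickle => // c.
case: pselect => /= BO; last exact: measurable0.
by have h := mB c; exact h.
Qed.

Lemma W11_primitive (t : R) (xi : R -> V) : 0 < t -> W11 0 t xi ->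
  forall i, primitive 0 t (fun s => xi s 0 i) (fun s => weak_derivative 0 t xi s 0 i).
Proof.
move=> t0 [cxi Ixi [g Hg]] i.
have [IW HW] := xgetPex (cst 0) (ex_intro _ g Hg : exists g, [set g | L1_curve 0 t g /\ is_weak_derivative 0 t xi g] g).
apply: weak_derivative_primitive => //; [|exact: IW|by move=> phi /HW].
apply/subspace_continuousP => s sab; apply/cvg_ballP => e e0.
have /subspace_continuousP/(_ s sab)/cvg_ballP/(_ e e0) := cxi.
by apply: filterS => y [_ Hy]; exact: Hy.
Qed.

(** The choice hidden in [weak_derivative] is harmless: two densities of the same primitive agree
    almost everywhere, so a competitor may be given with any explicit velocity [g]. *)
Lemma primitive_W11 (t : R) (xi g : R -> V) : 0 < t ->
  (forall i, primitive 0 t (fun s => xi s 0 i) (fun s => g s 0 i)) ->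
  W11 0 t xi /\ {ae mu, forall s, s \in `[0, t] -> weak_derivative 0 t xi s = g s}.
Proof.
move=> t0 H.
have W : W11 0 t xi.
  split.
  - apply/subspace_continuousP => s sab; apply/cvg_ballP => e e0.
    have : \forall y \near within `[0, t] (nbhs s), forall j, ball (xi s 0 j) e (xi y 0 j).
      apply: filter_forall_ord => j.
      have /subspace_continuousP/(_ s sab)/cvg_ballP := primitive_continuous (H j).
      exact.
    by apply: filterS => y Hy; split => // i j; rewrite (ord1 i).
  - move=> i; apply: continuous_compact_integrable; first exact: segment_compact.
    exact: primitive_continuous (H i).
  - exists g; split; first by move=> i; exact: (H i).1.
    by move=> phi tphi i; apply: primitive_parts => //; exact: ltW.
split => //; have HW := W11_primitive t0 W.
have := @filter_forall_ord _ _ n _ (ae_filter_ringOfSetsType mu) (fun i => primitive_ae_unique (HW i) (H i)).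
apply: ae_imp => s Hs sab; apply/rowP => i; exact: Hs.
Qed.

End vector_curves.

(** * Variation of constants and Picard iteration *)

Section gronwall.
Context {R : realType}.
Local Notation mu := (@lebesgue_measure R).
Implicit Types (a b : R) (f g h : R -> R).

(* [l] is chosen so that [D' = l D + h] holds exactly; where [D] vanishes the
   convention [0^-1 = 0] makes it [0]. *)
Lemma variation_of_constants a b D d h k : primitive a b D d ->
  mu.-integrable `[a, b] (EFin \o h) -> mu.-integrable `[a, b] (EFin \o k) ->
  (forall s, a <= s <= b -> `|d s - h s| <= k s * `|D s|) ->
  (forall s, a <= s <= b -> 0 <= k s) ->
  exists Lam, [/\ {within `[a, b], continuous Lam},
    forall s, a <= s <= b -> `|Lam s| <= \int[mu]_(x in `[a, s]) k x &
    forall s, a <= s <= b ->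
      D s = expR (Lam s) * (D a + \int[mu]_(x in `[a, s]) (expR (- Lam x) * h x))].
Proof.
move=> HD Ih Ik Hk k0.
pose l := (d \- h) \* (fun s => (D s)^-1).
have lk s : a <= s <= b -> `|l s| <= k s.
  move=> sab; rewrite /l/= normrM normfV; have [->|D0] := eqVneq (D s) 0.
    by rewrite normr0 invr0 mulr0 k0.
  by rewrite ler_pdivrMr ?normr_gt0// Hk.
have lD s : a <= s <= b -> l s * D s = d s - h s.
  move=> sab; rewrite /l/=; have [D0|D0] := eqVneq (D s) 0; last by rewrite divfK.
  have := Hk s sab; rewrite D0 normr0 mulr0 normr_le0 => /eqP ->.
  by rewrite !mul0r.
have mD : measurable_fun `[a, b] D by exact: continuous_within_measurable (primitive_continuous HD).
have Il : mu.-integrable `[a, b] (EFin \o l).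
  apply: (@integrable_dominated _ _ _ k) => //.
    apply: measurable_funM.
      apply: measurable_funB.
        by have /measurable_int/measurable_EFinP := HD.1.
      by have /measurable_int/measurable_EFinP := Ih.
    by apply: measurableT_comp mD; exact: measurable_inv.
pose Lam s := \int[mu]_(x in `[a, s]) l x.
have HL : primitive a b Lam l := int_primitive Il.
have INl : mu.-integrable `[a, b] (EFin \o (fun s => -1 * l s)).
  by have := integrableZl _ (-1) Il; exact.
have HNL : primitive a b (fun s => - Lam s) (fun s => - l s).
  have := primitive_sub (primitive_cst a b 0) HL.
  by apply: primitive_ext => s _ /=; rewrite sub0r.
have HE := primitive_exp HNL.
exists Lam; split; first exact: primitive_continuous HL.
  move=> s sab; apply: norm_Rintegral_le => //.
  - by apply: integrable_sub_itv Il => //; lra.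
  - by apply: integrable_sub_itv Ik => //; lra.
  - by move=> x; rewrite /= in_itv/= => xs; apply: lk; lra.
move=> s sab.
(* Since [D' = l D + h] and [Lam' = l], the derivative of [D] times [exp(-Lam)] is [exp(-Lam) h]. *)
have HP : primitive a b (fun s => D s * expR (- Lam s)) (fun s => expR (- Lam s) * h s).
  apply: primitive_ext (primitive_mul HD HE) => x xab //=.
  have := lD x xab => E.
  have -> : d x = l x * D x + h x by rewrite E subrK.
  ring.
have := HP.2 s sab.
have -> : Lam a = 0 by rewrite /Lam set_itv1 Rintegral_set1.
rewrite oppr0 expR0 mulr1 => <-.
by rewrite mulrC -mulrA -expRD addNr expR0 mulr1.
Qed.

Section picard.
Variables (a b w0 : R) (f : R -> R -> R) (k : R -> R).
Hypotheses (ab : a <= b) (Ik : mu.-integrable `[a, b] (EFin \o k)).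
Hypothesis k0 : forall s, a <= s <= b -> 0 <= k s.
Hypothesis fk : forall s u v, a <= s <= b -> `|f s u - f s v| <= k s * `|u - v|.
Hypothesis If0 : mu.-integrable `[a, b] (EFin \o f ^~ 0).
Hypothesis mf : forall w : R -> R, measurable_fun `[a, b] w ->
  measurable_fun `[a, b] (fun s => f s (w s)).

Let Ifw C (w : R -> R) : measurable_fun `[a, b] w -> (forall s, a <= s <= b -> `|w s| <= C) ->
  mu.-integrable `[a, b] (EFin \o (fun s => f s (w s))).
Proof.
move=> mw wC.
have I1 : mu.-integrable `[a, b] (EFin \o (fun s => `|f s 0| + C * k s)).
  have I2 : mu.-integrable `[a, b] (EFin \o (fun s => C * k s)).
    by have := integrableZl _ C Ik; exact.
  by have := integrableD _ (integrable_norm If0) I2; exact.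
apply: (integrable_dominated _ _ I1) => //; first exact: mf.
move=> s; rewrite /= in_itv/= => sab.
have := fk (w s) 0 sab; rewrite subr0 => h.
have : k s * `|w s| <= C * k s by rewrite mulrC ler_wpM2r ?k0 ?wC.
by have := ler_normD (f s (w s) - f s 0) (f s 0); rewrite subrK; lra.
Qed.

Let next (w : R -> R) (s : R) := w0 + \int[mu]_(x in `[a, s]) f x (w x).

Let next_primitive C (w : R -> R) : measurable_fun `[a, b] w -> (forall s, a <= s <= b -> `|w s| <= C) ->
  primitive a b (next w) (fun s => f s (w s)).
Proof.
move=> mw wC; have := primitive_add (primitive_cst a b w0) (int_primitive (Ifw mw wC)).
by apply: primitive_ext => s _ //=; rewrite add0r.
Qed.

Let W m := iter m next (cst w0).

Let W_continuous m : {within `[a, b], continuous (W m)}.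
Proof.
elim: m => [|m IH]; first exact: primitive_continuous (primitive_cst a b w0).
have [C _ HC] := continuous_within_bounded IH.
exact: primitive_continuous (next_primitive (continuous_within_measurable IH) HC).
Qed.

Let W_int m : mu.-integrable `[a, b] (EFin \o (fun s => f s (W m s))).
Proof.
have [C _ HC] := continuous_within_bounded (W_continuous (m := m)).
exact: Ifw (continuous_within_measurable (W_continuous (m := m))) HC.
Qed.

(** The weight of a Bielecki norm: [E' = 2 k E], so the integral of [k E] up to [s] is at most
    [E s / 2]. No smallness of the interval is then required, and [k] may be merely integrable, as
    happens for [K * al]. *)
Let E s := expR (2 * \int[mu]_(x in `[a, s]) k x).

Let E_primitive : primitive a b E (fun s => 2 * k s * E s).
Proof.
apply: (@primitive_exp _ _ _ (fun s => 2 * \int[mu]_(x in `[a, s]) k x) (fun s => 2 * k s)).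
have := primitive_mul (primitive_cst a b 2) (int_primitive Ik).
by apply: primitive_ext => s _ //=; rewrite mul0r add0r mulrC.
Qed.

Let E_ge1 s : a <= s <= b -> 1 <= E s.
Proof.
move=> sab; rewrite /E -expR0 ler_expR mulr_ge0// Rintegral_ge0// => x.
by rewrite /= in_itv/= => xs; apply: k0; lra.
Qed.

Let E_le s : a <= s <= b -> E s <= E b.
Proof.
move=> sab; rewrite -subr_ge0 (primitive_incr E_primitive)//; [|lra..].
apply: Rintegral_ge0 => x; rewrite /= in_itv/= => xs.
by rewrite !mulr_ge0 ?expR_ge0// k0//; lra.
Qed.

(* The weight [E] turns each step into a contraction of ratio [1/2]. *)
Let next_contract (u v : R -> R) M s : a <= s <= b ->
  mu.-integrable `[a, b] (EFin \o (fun s => f s (u s))) ->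
  mu.-integrable `[a, b] (EFin \o (fun s => f s (v s))) ->
  0 <= M -> (forall x, a <= x <= b -> `|u x - v x| <= M * E x) ->
  `|next u s - next v s| <= M / 2 * E s.
Proof.
move=> sab Iu Iv M0 uv.
have Iu' := integrable_sub_itv (lexx a) (proj2 (andP sab)) Iu.
have Iv' := integrable_sub_itv (lexx a) (proj2 (andP sab)) Iv.
rewrite /next opprD addrACA subrr add0r -RintegralB//.
have IE : mu.-integrable `[a, s] (EFin \o (fun x => M / 2 * (2 * k x * E x))).
  have := integrable_sub_itv (lexx a) (proj2 (andP sab)) E_primitive.1.
  by move=> /(integrableZl _ (M / 2)); exact.
apply: (@le_trans _ _ (\int[mu]_(x in `[a, s]) (M / 2 * (2 * k x * E x)))).
  apply: norm_Rintegral_le => //.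
    by have := integrableB _ Iu' Iv'; exact.
  move=> x; rewrite /= in_itv/= => xs.
  have xab : a <= x <= b by lra.
  apply: (le_trans (fk _ _ xab)).
  have -> : M / 2 * (2 * k x * E x) = k x * (M * E x) by field.
  by rewrite ler_wpM2l ?k0 ?uv.
rewrite RintegralZl//; last exact: (integrable_sub_itv (lexx a) (proj2 (andP sab)) E_primitive.1).
rewrite ler_wpM2l ?divr_ge0//.
have := E_primitive.2 s sab; have := E_ge1 (s := a); rewrite lexx ab => /(_ isT).
by move: (E s) (E a) => x y; lra.
Qed.

Lemma picard : exists w, w a = w0 /\ primitive a b w (fun s => f s (w s)).
Proof.
have [M1 M10 HM1] := continuous_within_bounded (W_continuous (m := 1)).
pose M := M1 + `|w0|; have M0 : 0 <= M by rewrite addr_ge0.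
pose q m : R := 2^-1 ^+ m.
have q0 m : 0 < q m by rewrite exprn_gt0.
have qS m : q m.+1 = q m / 2 by rewrite /q exprSr.
have step m s : a <= s <= b -> `|W m.+1 s - W m s| <= M * q m * E s.
  elim: m s => [|m IH] s sab.
    rewrite /q expr0 mulr1 (@le_trans _ _ (M * 1))// ?ler_wpM2l ?E_ge1// mulr1.
    by rewrite (le_trans (ler_normB _ _))// lerD// HM1.
  rewrite qS mulrA; apply: (@next_contract (W m.+1) (W m) (M * q m) s sab (W_int _) (W_int _)) => //.
    by rewrite mulr_ge0// ltW.
(* Because [2 M q_m - 2 M q_{m+1} = M q_m], the estimate [step] makes the intervals from [lo m s] to
   [hi m s] nested. The supremum of their left ends lies in all of them and is the limit [w s], with
   an explicit rate. *)
pose lo m s := W m s - 2 * M * q m * E s.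
pose hi m s := W m s + 2 * M * q m * E s.
have loS m s : a <= s <= b -> lo m s <= lo m.+1 s.
  move=> sab; have := step m s sab; rewrite ler_norml /lo qS => /andP[]; lra.
have hiS m s : a <= s <= b -> hi m.+1 s <= hi m s.
  move=> sab; have := step m s sab; rewrite ler_norml /hi qS => /andP[]; lra.
have lohi m s : a <= s <= b -> lo m s <= hi m s.
  move=> sab; rewrite /lo /hi; have : 0 <= 2 * M * q m * E s.
    by rewrite !mulr_ge0// ?expR_ge0// ltW.
  lra.
have lo_mono i j s : a <= s <= b -> (i <= j)%N -> lo i s <= lo j s.
  move=> sab /subnK <-; elim: (j - i)%N => [|m IH]; rewrite ?add0n//.
  by rewrite addSn (le_trans IH)// loS.
have hi_mono i j s : a <= s <= b -> (i <= j)%N -> hi j s <= hi i s.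
  move=> sab /subnK <-; elim: (j - i)%N => [|m IH]; rewrite ?add0n//.
  by rewrite addSn (le_trans _ IH)// hiS.
have lohi2 i j s : a <= s <= b -> lo i s <= hi j s.
  move=> sab; rewrite (le_trans (lo_mono _ _ _ sab (leq_maxl i j)))//.
  by rewrite (le_trans (lohi _ _ sab))// hi_mono// leq_maxr.
pose w s := if a <= s <= b then sup (range (lo ^~ s)) else 0.
have wW m s : a <= s <= b -> `|w s - W m s| <= 2 * M * q m * E s.
  move=> sab; rewrite /w sab.
  have ub : has_sup (range (lo ^~ s)).
    split; first by exists (lo 0%N s); exists 0%N.
    by exists (hi 0%N s) => _ [i _ <-]; exact: lohi2.
  have h1 : lo m s <= sup (range (lo ^~ s)) by apply: ub_le_sup; [exact: ub.2|exists m].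
  have h2 : sup (range (lo ^~ s)) <= hi m s.
    by apply: ge_sup; [exact: ub.1|move=> _ [i _ <-]; exact: lohi2].
  by move: h1 h2; rewrite /lo /hi ler_distl; lra.
pose C := 2 * M * E b.
have C0 : 0 <= C by rewrite !mulr_ge0// expR_ge0.
have wW' m s : a <= s <= b -> `|w s - W m s| <= C * q m.
  move=> sab; apply: (le_trans (wW m s sab)).
  rewrite /C mulrAC; apply: ler_wpM2r; first exact: ltW (q0 m).
  by apply: ler_wpM2l; [apply: mulr_ge0|exact: E_le].
have qlim : q m @[m --> \oo] --> (0 : R).
  by apply: cvg_expr; rewrite ger0_norm//; lra.
have mw : measurable_fun `[a, b] w.
  apply: (@measurable_fun_cvg _ _ _ _ W) => //.
    by move=> m; exact: continuous_within_measurable (W_continuous (m := m)).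
  move=> x; rewrite /= in_itv/= => xab; apply/cvgrPdist_le => e e0.
  have lim : C * q m @[m --> \oo] --> C * 0 by apply: cvgM => //; exact: cvg_cst.
  rewrite mulr0 in lim; move/cvgrPdist_le : lim => /(_ _ e0).
  apply: filterS => m; rewrite sub0r normrN ger0_norm; last by rewrite mulr_ge0 ?(ltW (q0 m)).
  by move=> he; apply: le_trans (wW' m x xab) he.
have wb s : a <= s <= b -> `|w s| <= C + `|w0|.
  move=> sab; have := wW' 0%N s sab; rewrite /q expr0 mulr1 /W/= => h.
  by rewrite (le_trans _ (lerD h (lexx `|w0|)))// -{1}(subrK w0 (w s)) ler_normD.
have Hn := next_primitive mw wb.
(* Both [next w s] and [w s] are within a multiple of [q m] of [W m.+1 s], for every [m]. *)
have key s : a <= s <= b -> next w s = w s.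
  move=> sab; apply/eqP; rewrite -subr_eq0 -normr_le0.
  have bnd m : `|next w s - w s| <= C * 2 * q m.
    have h1 : `|next w s - next (W m) s| <= 2 * M * q m / 2 * E s.
      apply: (@next_contract w (W m) (2 * M * q m) s sab (Ifw mw wb) (W_int _)); last exact: wW.
      by rewrite !mulr_ge0// ltW.
    have h2 := wW m.+1 s sab.
    have h3 : E s <= E b by exact: E_le.
    have -> : next w s - w s = (next w s - next (W m) s) - (w s - W m.+1 s).
      by rewrite opprB addrA subrK.
    rewrite (le_trans (ler_normB _ _))// (le_trans (lerD h1 h2))// qS.
    have -> : 2 * M * q m / 2 * E s + 2 * M * (q m / 2) * E s = 2 * (M * q m) * E s by field.
    have -> : C * 2 * q m = 2 * (M * q m) * (2 * E b) by rewrite /C; ring.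
    apply: ler_wpM2l.
      by apply: mulr_ge0 => //; apply: mulr_ge0 => //; exact: ltW (q0 m).
    have Eb0 : 0 <= E b := expR_ge0 _.
    by move: (E b) (E s) h3 Eb0 => x y; lra.
  have lim : C * 2 * q m @[m --> \oo] --> C * 2 * 0 by apply: cvgM => //; exact: cvg_cst.
  rewrite mulr0 in lim.
  rewrite -(cvg_lim (@Rhausdorff R) lim); apply: limr_ge.
    by apply/cvg_ex; exists 0.
  exact: nearW.
exists w; split.
  by rewrite -key ?lexx// /next set_itv1 Rintegral_set1 addr0.
by apply: primitive_ext Hn => // s sab; exact: key.
Qed.

End picard.
End gronwall.

(** * Change of time *)

Section time_change.
Context {R : realType}.
Local Notation mu := (@lebesgue_measure R).
Implicit Types (f g : R -> R).

(* The image of the Lebesgue measure under [tau] and the measure of density [g]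
   are both the Lebesgue-Stieltjes measure of [sg]. *)
Lemma preimage_null (sg tau g : R -> R) : measurable_fun setT tau ->
  measurable_fun setT g -> (forall x, 0 <= g x) ->
  {homo sg : x y / x <= y} -> continuous sg ->
  (forall a b, a <= b -> tau @^-1` `]a, b] = `]sg a, sg b]%classic) ->
  (forall a b, a <= b -> (\int[mu]_(x in `]a, b]) (g x)%:E = (sg b - sg a)%:E)%E) ->
  forall N : set (measurableTypeR R), measurable N -> mu N = 0%E -> mu (tau @^-1` N) = 0%E.
Proof.
move=> mtau mg g0 nd csg ptau ig N mN N0.
have rc : right_continuous sg by apply: right_continuousW.
pose F : cumulative R R := HB.pack sg (isCumulative.Build R _ R sg nd rc).
pose m1 (A : set (measurableTypeR R)) := mu (tau @^-1` A).
have nu1_0 : m1 set0 = 0%E by rewrite /m1 preimage_set0 measure0.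
have nu1_ge0 (A : set (measurableTypeR R)) : (0 <= m1 A)%E by [].
have mpre (A : set (measurableTypeR R)) : measurable A -> measurable (tau @^-1` A).
  by move=> mA; rewrite -[X in measurable X]setTI; exact: mtau.
have nu1_s : semi_sigma_additive m1.
  move=> /= G mG tG mUG; rewrite /m1 preimage_bigcup.
  apply: measure_semi_sigma_additive.
  - by move=> m; exact: mpre.
  - apply/trivIsetP => /= i j _ _ ij; rewrite -preimage_setI.
    by move/trivIsetP : tG => /(_ _ _ _ _ ij) ->//; rewrite preimage_set0.
  - by rewrite -preimage_bigcup; exact: mpre.
pose nu1 : {measure set (measurableTypeR R) -> \bar R} :=
  HB.pack m1 (isMeasure.Build _ (measurableTypeR R) R m1 nu1_0 nu1_ge0 nu1_s).
pose d (A : set (measurableTypeR R)) := (\int[mu]_(x in A) (g x)%:E)%E.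
have nu2_0 : d set0 = 0%E by rewrite /d integral_set0.
have nu2_ge0 (A : set (measurableTypeR R)) : (0 <= d A)%E.
  by apply: integral_ge0 => x _; rewrite lee_fin.
have nu2_s : semi_sigma_additive d.
  by apply: semi_sigma_additive_nng_induced; [exact/measurable_EFinP|move=> x; rewrite lee_fin].
pose nu2 : {measure set (measurableTypeR R) -> \bar R} :=
  HB.pack d (isMeasure.Build _ (measurableTypeR R) R d nu2_0 nu2_ge0 nu2_s).
(* Two measures that agree with the Stieltjes length on half-open intervals are the Stieltjes
   measure itself; [E1] does this for the image measure and [E2] for the density. *)
have E1 : forall A, measurable A -> lebesgue_stieltjes_measure F A = nu1 A.
  apply: lebesgue_stieltjes_measure_unique => I [[a b]]/= _ <-.
  rewrite /lebesgue_stieltjes_measure /measure_extension.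
  rewrite measurable_mu_extE/=; last exact: is_ocitv.
  have [ab|ba] := leP a b; last first.
    by rewrite set_itv_ge ?wlength0 ?nu1_0// bnd_simp -leNgt ltW.
  rewrite wlength_itv_bnd//.
  rewrite /m1 ptau// lebesgue_measure_itv/= lte_fin.
  case: ltP => h; first by rewrite EFinB.
  have -> : sg b = sg a by have := nd _ _ ab; lra.
  by rewrite subrr.
have E2 : forall A, measurable A -> lebesgue_stieltjes_measure F A = nu2 A.
  apply: lebesgue_stieltjes_measure_unique => I [[a b]]/= _ <-.
  rewrite /lebesgue_stieltjes_measure /measure_extension.
  rewrite measurable_mu_extE/=; last exact: is_ocitv.
  have [ab|ba] := leP a b; last first.
    by rewrite set_itv_ge ?wlength0 ?nu2_0// bnd_simp -leNgt ltW.
  rewrite wlength_itv_bnd//.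
  by rewrite /d ig// EFinB.
have -> : mu (tau @^-1` N) = nu2 N by rewrite -E2// E1.
rewrite [LHS]/(d _) /d; apply: null_set_integral => //.
by apply/measurable_EFinP; exact: measurable_funTS.
Qed.

Variables (t : R) (al : R -> R).
Hypotheses (t0 : 0 < t) (Ial : mu.-integrable `[0, t] (EFin \o al)).
Hypothesis al_ge : forall s, 0 <= s <= t -> 1 / 2 <= al s.
Hypothesis al_int : \int[mu]_(s in `[0, t]) al s = t.

(** Extending [al - 1] by 0 makes [sg] a homeomorphism of the whole line that is the identity
    outside [[0, t]], the integral of [al] being [t]. Its inverse is then defined everywhere, as
    [preimage_null] requires. *)
Let be : R -> R := (fun s => al s - 1) \_ `]0, t].

Let beE s : 0 < s <= t -> be s = al s - 1.
Proof. by move=> st; rewrite /be patchE mem_set//= in_itv. Qed.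

Let be0 s : s <= 0 \/ t < s -> be s = 0.
Proof. by move=> st; rewrite /be patchE memNset//= in_itv/=; lra. Qed.

Let be_ge s : - (1 / 2) <= be s.
Proof.
have [st|st] := boolP (0 < s <= t).
  have h : 0 <= s <= t by lra.
  by rewrite beE//; have := al_ge h; lra.
rewrite be0; first lra.
by move: st; rewrite negb_and -leNgt -ltNge => /orP.
Qed.

Let Ibe : mu.-integrable setT (EFin \o be).
Proof.
rewrite /be -restrict_EFin; apply/integrable_restrict => //=; rewrite setTI.
have I0 : mu.-integrable `]0, t] (EFin \o al).
  by apply: integrableS Ial => // x /=; rewrite !in_itv/=; lra.
have I1 : mu.-integrable `]0, t] (EFin \o cst 1).
  by apply: integrableS (integrable_cst_itv 0 t 1) => // x /=; rewrite !in_itv/=; lra.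
by have := integrableB _ I0 I1; exact.
Qed.

Let IbeD (D : set R) : measurable D -> mu.-integrable D (EFin \o be).
Proof. by move=> mD; apply: integrableS Ibe. Qed.

Let Bp (s : R) : R := \int[mu]_(x in `]-oo, s]) be x.
Let sg (s : R) : R := s + Bp s.

Let BpB x y : x <= y -> Bp y - Bp x = \int[mu]_(z in `]x, y]) be z.
Proof. by move=> xy; rewrite /Bp Rintegral_itvB//; apply: IbeD. Qed.

Let Bp0 : Bp 0 = 0.
Proof.
rewrite /Bp; have -> : \int[mu]_(x in `]-oo, 0]) be x = \int[mu]_(x in `]-oo, 0]) (cst 0 x).
  by apply: eq_Rintegral => x; rewrite inE/= in_itv/= => x0; rewrite be0//; left.
by rewrite Rintegral_cst ?mul0r.
Qed.

Let sgE s : 0 <= s <= t -> sg s = \int[mu]_(x in `[0, s]) al x.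
Proof.
move=> /andP[s0 st]; have := BpB s0; rewrite Bp0 subr0 /sg => ->.
have I0 : mu.-integrable `]0, s] (EFin \o al).
  by apply: integrableS Ial => // x /=; rewrite !in_itv/=; lra.
have I1 : mu.-integrable `]0, s] (EFin \o cst 1).
  by apply: integrableS (integrable_cst_itv 0 t 1) => // x /=; rewrite !in_itv/=; lra.
have -> : \int[mu]_(z in `]0, s]) be z = \int[mu]_(z in `]0, s]) (al z - cst 1 z).
  by apply: eq_Rintegral => x; rewrite inE/= in_itv/= => xs; rewrite beE//=; lra.
rewrite RintegralB// Rintegral_itv_obnd_cbnd//.
rewrite Rintegral_cst//= lebesgue_measure_itv/= lte_fin.
by case: ltP => h /=; rewrite ?oppr0 ?addr0; lra.
Qed.

Let sg_out s : s <= 0 \/ t <= s -> sg s = s.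
Proof.
move=> [s0|ts].
  have := BpB s0; rewrite Bp0 sub0r => h.
  have h0 : \int[mu]_(z in `]s, 0]) be z = 0.
    have -> : \int[mu]_(z in `]s, 0]) be z = \int[mu]_(z in `]s, 0]) (cst 0 z).
      by apply: eq_Rintegral => x; rewrite inE/= in_itv/= => xs; rewrite be0//; left; lra.
    by rewrite Rintegral_cst ?mul0r.
  have -> : sg s = s + Bp s by [].
  have -> : Bp s = 0 by apply/eqP; rewrite -oppr_eq0; apply/eqP; rewrite h h0.
  by rewrite addr0.
have := BpB ts => h.
have h0 : \int[mu]_(z in `]t, s]) be z = 0.
  have -> : \int[mu]_(z in `]t, s]) be z = \int[mu]_(z in `]t, s]) (cst 0 z).
    by apply: eq_Rintegral => x; rewrite inE/= in_itv/= => xs; rewrite be0//; right; lra.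
  by rewrite Rintegral_cst ?mul0r.
have Bt : Bp t = 0.
  have : sg t = t by rewrite sgE ?al_int// lexx ltW.
  by rewrite /sg => /(congr1 (fun z => z - t)); rewrite /= addrAC subrr add0r.
have Bs : Bp s = Bp t by apply/eqP; rewrite -subr_eq0; apply/eqP; rewrite h h0.
by rewrite /sg Bs Bt addr0.
Qed.

(** The lower bound 1/2 on the density makes the inverse of [sg] Lipschitz with constant 2. *)
Let sg_incr x y : x <= y -> (y - x) / 2 <= sg y - sg x.
Proof.
move=> xy; have : - (1 / 2) * (y - x) <= Bp y - Bp x.
  rewrite BpB//.
  have Ic : mu.-integrable `]x, y] (EFin \o cst (- (1 / 2))).
    by apply: integrableS (integrable_cst_itv x y _) => // z /=; rewrite !in_itv/=; lra.
  have := @le_Rintegral _ _ _ mu `]x, y] _ _ _ Ic (IbeD _) (fun z _ => be_ge z).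
  rewrite Rintegral_cst//.
  have -> : fine (mu `]x, y]) = y - x.
    rewrite lebesgue_measure_itv/= lte_fin; case: ltP => //= h.
    by apply/eqP; rewrite eq_sym subr_eq0 eq_le xy h.
  by move=> /(_ (measurable_itv _) (measurable_itv _)).
move=> h; have -> : sg y - sg x = (y - x) + (Bp y - Bp x) by rewrite /sg opprD addrACA.
by move: h; set z := Bp y - Bp x; lra.
Qed.

Let sg_lt x y : x < y -> sg x < sg y.
Proof. by move=> xy; have := sg_incr (ltW xy); lra. Qed.

Let sg_le x y : (sg x <= sg y) = (x <= y).
Proof. by apply: (le_mono sg_lt). Qed.

Let sg_continuous : continuous sg.
Proof.
move=> x; apply: cvgD; first exact: cvg_id.
apply/cvgrPdist_lt => e e0; have [d [d0 H]] := integral_normr_continuous Ibe e0.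
apply/nbhs_ballP; exists d => //= y; rewrite /ball/= => xyd.
have key u v : u <= v -> v - u < d -> `|Bp v - Bp u| < e.
  move=> uv vud; rewrite BpB//.
  have muI : (mu `]u, v] < d%:E)%E.
    have <- : ((v - u)%:E = mu `]u, v])%E.
      rewrite lebesgue_measure_itv/= lte_fin; case: ltP => // h.
      by rewrite EFinB [in LHS](_ : v = u) ?subee//; apply/eqP; rewrite eq_le h.
    by rewrite lte_fin.
  apply: le_lt_trans (H _ (measurable_itv _) muI).
  by apply: le_normr_Rintegral => //; exact: IbeD.
have [xy|/ltW yx] := leP x y.
  by rewrite distrC; apply: key => //; rewrite -(ger0_norm (x := y - x)) ?subr_ge0// distrC.
by apply: key => //; rewrite -(ger0_norm (x := x - y)) ?subr_ge0.
Qed.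

Let sg_surj y : exists s, sg s = y.
Proof.
have [y0|y0] := leP y 0; first by exists y; rewrite sg_out//; left.
have [yt|yt] := leP t y; first by exists y; rewrite sg_out//; right.
have sg0 : sg 0 = 0 by rewrite sg_out//; left.
have sgt : sg t = t by rewrite sg_out//; right.
have [||c _ <-] := @IVT R sg 0 t y (ltW t0); last by exists c.
  exact: continuous_subspaceT.
by rewrite sg0 sgt (min_idPl (ltW t0)) (max_idPr (ltW t0)) !ltW.
Qed.

(** Here [tau] is the inverse of [sg], that is, the old time as a function of the new one. The bound
    of [g] by [C * al] says that the new velocity is at most [C]. *)
Lemma time_change : exists tau : R -> R,
  [/\ tau 0 = 0, tau t = t, forall y, 0 <= y <= t -> 0 <= tau y <= t &
    forall C f g, primitive 0 t f g -> (forall s, 0 <= s <= t -> `|g s| <= C * al s) ->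
    primitive 0 t (f \o tau) (fun y => g (tau y) / al (tau y))].
Proof.
have [tau tauK] := choice sg_surj.
have sg_inj x y : sg x = sg y -> x = y.
  by move=> h; apply/le_anti; rewrite -sg_le -[X in _ && X]sg_le h lexx.
have sgK s : tau (sg s) = s by apply: sg_inj; rewrite tauK.
have tau0 : tau 0 = 0 by apply: sg_inj; rewrite tauK sg_out//; left.
have taut : tau t = t by apply: sg_inj; rewrite tauK sg_out//; right.
have tau_le x y : (tau x <= tau y) = (x <= y) by rewrite -sg_le !tauK.
have tau_in y : 0 <= y <= t -> 0 <= tau y <= t.
  move=> /andP[y0 yt]; apply/andP; split; first by rewrite -tau0 tau_le.
  by rewrite -[X in _ <= X]taut tau_le.
have tau_lip x y : x <= y -> 0 <= tau y - tau x <= 2 * (y - x).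
  move=> xy; have h : tau x <= tau y by rewrite tau_le.
  by have := sg_incr h; rewrite !tauK; lra.
have ctau : continuous tau.
  move=> x; apply/cvgrPdist_lt => e e0; apply/nbhs_ballP; exists (e / 2); first by rewrite /= divr_gt0.
  move=> y; rewrite /ball/= !ltr_distl => h.
  by have [/tau_lip|/ltW/tau_lip] := leP x y; lra.
have mtau : measurable_fun setT tau by exact: continuous_measurable_fun.
have mbe : measurable_fun setT (fun x => 1 + be x).
  by apply: measurable_funD => //; have /measurable_int/measurable_EFinP := Ibe.
have be1 x : 0 <= 1 + be x by have := be_ge x; lra.
have nd : {homo sg : x y / x <= y} by move=> x y; rewrite sg_le.
have e1 a y : (sg a < y) = (a < tau y) by rewrite -[in LHS](tauK y) !ltNge sg_le.
have e2 b y : (y <= sg b) = (tau y <= b) by rewrite -[in LHS](tauK y) sg_le.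
have ptau a b : a <= b -> tau @^-1` `]a, b] = `]sg a, sg b]%classic.
  by move=> ab; apply/seteqP; split => y /=; rewrite !in_itv/= e1 e2.
have ig a b : a <= b -> (\int[mu]_(x in `]a, b]) (1 + be x)%:E = (sg b - sg a)%:E)%E.
  move=> ab.
  have I1 : mu.-integrable `]a, b] (EFin \o cst 1).
    by apply: integrableS (integrable_cst_itv a b 1) => // x /=; rewrite !in_itv/=; lra.
  have I2 : mu.-integrable `]a, b] (EFin \o be) by exact: IbeD.
  have I3 : mu.-integrable `]a, b] (fun x => (1 + be x)%:E) by have := integrableD _ I1 I2; exact.
  rewrite -[LHS]fineK; last exact: integrable_fin_num.
  congr (_%:E); rewrite -[LHS]/(\int[mu]_(x in `]a, b]) (cst 1 x + be x)).
  rewrite RintegralD// -BpB// Rintegral_cst//= lebesgue_measure_itv/= lte_fin /sg.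
  by case: ltP => h /=; lra.
have null := preimage_null mtau mbe be1 nd sg_continuous ptau ig.
have Hsg : primitive 0 t sg al.
  apply: primitive_ext (int_primitive Ial) => // s st.
  by rewrite sgE.
exists tau; split => // C f g Hf gC.
have Hft : primitive 0 t (f \o tau) (fun y => g (tau y) / al (tau y)).
  (* The integral of [C * al] between [tau x] and [tau y] is exactly [C * (y - x)]. *)
  have lip x y : 0 <= x -> x <= y -> y <= t -> `|(f \o tau) y - (f \o tau) x| <= C * (y - x).
    move=> x0 xy yt /=.
    have /andP[tx0 txt] : 0 <= tau x <= t by apply: tau_in; lra.
    have /andP[ty0 tyt] : 0 <= tau y <= t by apply: tau_in; lra.
    have txy : tau x <= tau y by rewrite tau_le.
    have IC : mu.-integrable `[tau x, tau y] (EFin \o (fun s => C * al s)).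
      by have := integrableZl _ C (integrable_sub_itv tx0 tyt Ial); exact.
    rewrite (primitive_incr Hf)//.
    apply: (@le_trans _ _ (\int[mu]_(s in `[tau x, tau y]) (C * al s))).
      apply: norm_Rintegral_le => //; first exact: integrable_sub_itv Hf.1.
      by move=> s; rewrite /= in_itv/= => h; apply: gC; lra.
    rewrite RintegralZl//; last exact: integrable_sub_itv Ial.
    by rewrite -(primitive_incr Hsg)// !tauK.
  have ac : absolutely_continuous 0 t (f \o tau) by exact: lipschitz_ac lip.
  have mtau' : measurable_fun `[0, t] tau by exact: measurable_funTS.
  have mcomp u : measurable_fun `[0, t] u -> measurable_fun `[0, t] (u \o tau).
    move=> mu'; apply: (measurable_comp (F := `[0, t]%classic)) => //.
    by move=> _ [y + <-]; rewrite /= !in_itv/=; exact: tau_in.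
  have mg : measurable_fun `[0, t] g by have /measurable_int/measurable_EFinP := Hf.1.
  have mal : measurable_fun `[0, t] al by have /measurable_int/measurable_EFinP := Ial.
  have al0 s : 0 <= s <= t -> 0 < al s by move=> st; have := al_ge st; lra.
  have dC y : 0 <= y <= t -> `|g (tau y) / al (tau y)| <= C.
    move=> /tau_in yt; rewrite normrM normfV (gtr0_norm (al0 _ yt)).
    by rewrite ler_pdivrMr ?al0// gC.
  apply: ac_primitive => //.
    apply: (@integrable_dominated _ _ _ (cst C)) => //.
    - apply: measurable_funM; first exact: mcomp.
      by apply: measurableT_comp; [exact: measurable_inv|exact: mcomp].
    - exact: integrable_cst_itv.
  (* The chain rule holds at [y] as soon as [f] and [sg] have the expected derivatives at [tau y].
     The bad [y] lie in the preimage under [tau] of a null set, which is null by [null]. *)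
  have := ae_conj (ae_conj (ae_neq 0) (ae_neq t)) (ae_conj (primitive_ae Hf) (primitive_ae Hsg)).
  move=> [N [mN N0 subN]]; exists (tau @^-1` N); split.
  - by rewrite -[X in measurable X]setTI; exact: mtau.
  - exact: null.
  move=> y /= hy; apply: subN => /= -[[ty0 tyt] [df ds]]; apply: hy => yt.
  have tyin : tau y \in `[0, t] by rewrite in_itv/= tau_in//; rewrite in_itv in yt.
  have nr (P : R -> Prop) : (forall z, P z) -> \forall z \near tau y, P z.
    by move=> h; apply: (filterS _ (@filterT _ (nbhs (tau y)) _)) => z _; exact: h.
  have dt : is_derive (sg (tau y)) 1 tau (al (tau y))^-1.
    apply: (is_derive_inverse _ _ (ds tyin)).
    - exact: (nr _ sgK).
    - exact: (nr _ sg_continuous).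
    - by rewrite gt_eqF// al0//; move: tyin; rewrite in_itv.
  rewrite tauK in dt.
  exact: (@is_derive1_comp R f tau y _ _ (df tyin) dt).
exact: Hft.
Qed.

End time_change.

(** * The Herglotz equation *)

Section herglotz_primitive.
Context {R : realType} {n : nat}.
Local Notation mu := (@lebesgue_measure R).
Local Notation V := 'rV[R]_n.
Variable L : V -> R -> V -> R.

Lemma Rintegral_cst_itv (a b c : R) : a <= b -> \int[mu]_(x in `[a, b]) c = c * (b - a).
Proof.
move=> ab; rewrite Rintegral_cst//= lebesgue_measure_itv/= lte_fin.
case: ltP => h //=; have -> : b = a by lra.
by rewrite subrr.
Qed.

Lemma lagrangian_continuous : lagrangian_C2 L ->
  continuous (fun p : V * R * V => L p.1.1 p.1.2 p.2).
Proof. by move=> [dL _] x; exact: differentiable_continuous. Qed.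

Lemma lagrangian_lipschitz K : lagrangian_C2 L ->
  (forall x r v, `|derive1 (L x ^~ v) r| <= K) ->
  forall x v r r', `|L x r v - L x r' v| <= K * `|r - r'|.
Proof.
move=> [dL _] HK x v.
have D (r : R) : is_derive r 1 (L x ^~ v) (derive1 (L x ^~ v) r).
  have dd : differentiable (L x ^~ v : R -> R) r.
    apply: (@differentiable_comp _ _ _ _ (fun r : R => ((x, r), v) : V * R * V) (fun p => L p.1.1 p.1.2 p.2)).
      apply: differentiable_pair => //; exact: differentiable_pair.
    exact: dL.
  by split; [exact/derivable1_diffP|rewrite derive1E].
have key r r' : r < r' -> `|L x r v - L x r' v| <= K * `|r - r'|.
  move=> rr'; rewrite distrC [X in _ * X]distrC.
  have [c _ ->] := @MVT R _ _ r r' rr' (fun c _ => D c) ltac:(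
    by apply: continuous_subspaceT => c; apply/differentiable_continuous/derivable1_diffP; have [] := D c).
  by rewrite normrM ler_wpM2r.
move=> r r'; have [rr'|rr'|->] := ltgtP r r'; [exact: key| |].
  by rewrite distrC [X in _ * X]distrC; exact: key.
by rewrite !subrr normr0 mulr0.
Qed.

Variables (K c0 t u0 : R).
Hypotheses (cL : continuous (fun p : V * R * V => L p.1.1 p.1.2 p.2)).
Hypothesis LK : forall x v r r', `|L x r v - L x r' v| <= K * `|r - r'|.
Hypothesis L0 : forall x v, - c0 <= L x 0 v.
Hypotheses (K0 : 0 <= K) (t0 : 0 < t).

Lemma measurable_lagrangian (xi g : R -> V) (w : R -> R) :
  (forall i, measurable_fun `[0, t] (fun s => xi s 0 i)) -> measurable_fun `[0, t] w ->
  (forall i, measurable_fun `[0, t] (fun s => g s 0 i)) ->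
  measurable_fun `[0, t] (fun s => L (xi s) (w s) (g s)).
Proof.
move=> mx mw mg.
exact: (@measurable_fun_continuous3 R n `[0, t]%classic _ xi g w (measurable_itv _) cL).
Qed.

Lemma primitive_measurable (f g : R -> R) : primitive 0 t f g ->
  measurable_fun `[0, t] f /\ measurable_fun `[0, t] g.
Proof.
move=> H; split; first exact: continuous_within_measurable (primitive_continuous H).
by have /measurable_int/measurable_EFinP := H.1.
Qed.

Lemma lagrangian_lb x r v : - c0 - K * `|r| <= L x r v.
Proof.
have := LK x v r 0; rewrite subr0 ler_distl => /andP[h _].
by have := L0 x v; lra.
Qed.

(** As [u] is bounded, the Lagrangian is bounded below along the curve, and [ac_integrable_lb] gives
    its integrability. *)
Lemma herglotz_primitive (xi : R -> V) (u : R -> R) : W11 0 t xi ->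
  herglotz_solution L t u0 xi u ->
  primitive 0 t u (fun s => L (xi s) (u s) (weak_derivative 0 t xi s)).
Proof.
move=> W [acu uu0 du].
have cu := ac_continuous acu; have [C C0 HC] := continuous_within_bounded cu.
apply: ac_primitive => //.
apply: (ac_integrable_lb (C := c0 + K * C) acu) du.
  apply: measurable_lagrangian.
  - by move=> i; have [] := primitive_measurable (W11_primitive t0 W i).
  - exact: continuous_within_measurable.
  - by move=> i; have [] := primitive_measurable (W11_primitive t0 W i).
move=> s st; apply: le_trans (lagrangian_lb _ _ _).
by rewrite opprD lerD2l lerN2 ler_wpM2l// HC.
Qed.

(** Variation of constants for [u1 - u2] with zero source and zero initial value. *)
Lemma herglotz_unique (xi g : R -> V) (u1 u2 : R -> R) :
  primitive 0 t u1 (fun s => L (xi s) (u1 s) (g s)) ->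
  primitive 0 t u2 (fun s => L (xi s) (u2 s) (g s)) -> u1 0 = u2 0 ->
  forall s, 0 <= s <= t -> u1 s = u2 s.
Proof.
move=> H1 H2 E0 s st.
have [||Lam [_ _ HD]] := variation_of_constants (primitive_sub H1 H2)
    (integrable_cst_itv 0 t 0) (integrable_cst_itv 0 t K).
- by move=> x _ /=; rewrite subr0; exact: LK.
- by [].
have := HD s st; rewrite /= E0 subrr add0r.
have -> : \int[mu]_(x in `[0, s]) (expR (- Lam x) * 0) = \int[mu]_(x in `[0, s]) 0.
  by apply: eq_Rintegral => x _; rewrite mulr0.
rewrite Rintegral_cst_itv ?mul0r ?mulr0//; last by case/andP: st.
by move=> /eqP; rewrite subr_eq0 => /eqP.
Qed.

(** [action] is computed with the solution selected by [u_of]; uniqueness allows any solution at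
    hand to replace it. *)
Lemma action_herglotz (xi : R -> V) (u : R -> R) : W11 0 t xi ->
  herglotz_solution L t u0 xi u -> action L t u0 xi = u t - u0.
Proof.
move=> W Hu.
have Hw : herglotz_solution L t u0 xi (u_of L t u0 xi).
  by apply: (@xgetPex _ (cst 0) [set u | herglotz_solution L t u0 xi u]); exists u.
have P1 := herglotz_primitive W Hu; have P2 := herglotz_primitive W Hw.
have [_ e1 _] := Hu; have [_ e2 _] := Hw.
rewrite /action -(primitive_incr P2) ?lexx ?(ltW t0)// e2.
by rewrite (herglotz_unique P2 P1) ?e1 ?e2// lexx ltW.
Qed.

Lemma competitor (x0 x : V) (xi g : R -> V) (w : R -> R) :
  (forall i, primitive 0 t (fun s => xi s 0 i) (fun s => g s 0 i)) ->
  primitive 0 t w (fun s => L (xi s) (w s) (g s)) -> w 0 = u0 ->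
  xi 0 = x0 -> xi t = x ->
  admissible L x0 x t u0 xi /\ action L t u0 xi = w t - u0.
Proof.
move=> Hxi Hw w0 xi0 xit; have [W Wae] := primitive_W11 t0 Hxi.
have Hs : herglotz_solution L t u0 xi w.
  split => //; first exact: primitive_ac Hw.
  apply: ae_imp (ae_conj Wae (primitive_ae Hw)) => s [e d] st.
  by rewrite e//; exact: d.
split; last exact: action_herglotz.
by split; [split|exists w].
Qed.

Lemma minimizer_primitive (x0 x : V) (xi : R -> V) : minimizer L x0 x t u0 xi ->
  exists u, [/\ primitive 0 t u (fun s => L (xi s) (u s) (weak_derivative 0 t xi s)),
    u 0 = u0, forall i, primitive 0 t (fun s => xi s 0 i) (fun s => weak_derivative 0 t xi s 0 i),
    xi 0 = x0 /\ xi t = x &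
    forall eta, admissible L x0 x t u0 eta -> u t - u0 <= action L t u0 eta].
Proof.
move=> [[[W xi0 xit] [u Hu]] Hmin]; exists u.
split => //; first exact: herglotz_primitive.
- by have [] := Hu.
- exact: W11_primitive.
- by move=> eta /Hmin; rewrite (action_herglotz W Hu).
Qed.

End herglotz_primitive.

(** * The speed estimate *)

Section enorm.
Context {R : realType} {n : nat}.
Local Notation mu := (@lebesgue_measure R).
Local Notation V := 'rV[R]_n.

Lemma enorm_ge0 (v : V) : 0 <= enorm v.
Proof. exact: sqrtr_ge0. Qed.

Lemma enormZ (a : R) (v : V) : enorm (a *: v) = `|a| * enorm v.
Proof.
rewrite /enorm -sqrtr_sqr -sqrtrM ?sqr_ge0//; congr (Num.sqrt _).
by rewrite mulr_sumr; apply: eq_bigr => i _; rewrite mxE exprMn.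
Qed.

Lemma coord_le_enorm (v : V) i : `|v 0 i| <= enorm v.
Proof.
rewrite -sqrtr_sqr /enorm ler_sqrt ?sumr_ge0// => [|j _]; last exact: sqr_ge0.
by rewrite (bigD1 i)//= lerDl sumr_ge0// => j _; exact: sqr_ge0.
Qed.

Lemma measurable_enorm (D : set R) (v : R -> V) : measurable D ->
  (forall i, measurable_fun D (fun s => v s 0 i)) -> measurable_fun D (fun s => enorm (v s)).
Proof.
move=> mD mv; apply: (@measurableT_comp _ _ _ _ _ _ (@Num.sqrt R)).
  by apply: continuous_measurable_fun; exact: sqrt_continuous.
by apply: measurable_sum => i; exact: measurable_funX.
Qed.

End enorm.

Section convexity.
Context {R : realType} {n : nat}.
Local Notation V := 'rV[R]_n.

(* [v / (1 - d)] is a convex combination of [v] and [2 v]. *)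
Lemma convex_speed_up (f : V -> R) (v : V) (d : R) : strictly_convex f -> 0 <= d <= 1 / 2 ->
  (1 - d) * f ((1 - d)^-1 *: v) <= (1 - 2 * d) * f v + d * f (2 *: v).
Proof.
move=> cf /andP[d0 d2]; have e0 : 0 < 1 - d by lra.
(* Strict convexity needs distinct points and weights in the open interval, so [d = 0], [d = 1 / 2]
   and [v = 0] are treated apart; each is immediate. *)
have [->|dn0] := eqVneq d 0; first by rewrite subr0 invr1 !scale1r mulr0 subr0 mul0r addr0.
have [d1|d1] := eqVneq d (1 / 2).
  have -> : (1 - d)^-1 = 2 by rewrite d1; field.
  by rewrite d1; lra.
have [->|vn0] := eqVneq v 0; first by rewrite !scaler0; lra.
have dp : 0 < d by rewrite lt_neqAle eq_sym dn0.
have d2' : d < 1 / 2 by rewrite lt_neqAle d1.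
(* This weight solves [l + 2 (1 - l) = 1 / (1 - d)]; after multiplication by [1 - d] the two weights
   become [1 - 2 d] and [d]. *)
pose l := (1 - 2 * d) / (1 - d).
have l0 : 0 < l by rewrite divr_gt0//; lra.
have l1 : l < 1 by rewrite ltr_pdivrMr//; lra.
have v2 : v != 2 *: v.
  apply/eqP => h; move: vn0; apply/negP; rewrite negbK.
  have : 2 *: v - v = 0 by rewrite -h subrr.
  by rewrite -[X in _ - X]scale1r -scalerBl (_ : 2 - 1 = 1 :> R) ?scale1r => [->//|]; lra.
have := cf v (2 *: v) l v2; rewrite l0 l1 => /(_ isT)/ltW.
have -> : l *: v + (1 - l) *: (2 *: v) = (1 - d)^-1 *: v.
  by rewrite scalerA -scalerDl; congr (_ *: _); rewrite /l; field; rewrite gt_eqF.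
rewrite -(ler_pM2l e0) => h; apply: (le_trans h).
by rewrite le_eqVlt; apply/orP; left; apply/eqP; rewrite /l; field; rewrite gt_eqF.
Qed.

End convexity.

Section lipschitz_estimate.
Context {R : realType} {n : nat}.
Local Notation mu := (@lebesgue_measure R).
Local Notation V := 'rV[R]_n.
Variables (L : V -> R -> V -> R) (K c0 u0 Rad : R) (th0 th1 : R -> R).
Hypotheses (cL : continuous (fun p : V * R * V => L p.1.1 p.1.2 p.2)).
Hypothesis LK : forall x v r r', `|L x r v - L x r' v| <= K * `|r - r'|.
Hypothesis convL : forall x r, strictly_convex (L x r).
Hypothesis L_bounds : forall x v, th0 (enorm v) - c0 <= L x 0 v <= th1 (enorm v).
Hypothesis th0_ge0 : forall r, 0 <= r -> 0 <= th0 r.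
Hypothesis th1_ge0 : forall r, 0 <= r -> 0 <= th1 r.
Hypothesis th1_mono : forall r s, 0 <= r -> r <= s -> th1 r <= th1 s.
Hypothesis th0_super : forall q m : R, exists2 M, m <= M & forall r, M <= r -> q * r <= th0 r.
Hypotheses (K0 : 0 <= K) (c00 : 0 <= c0) (Rad0 : 0 < Rad).

Let L_lb x v : - c0 <= L x 0 v.
Proof. by have /andP[h _] := L_bounds x v; have := th0_ge0 (enorm_ge0 v); lra. Qed.

Let L_ub x v r : enorm v <= r -> L x 0 v <= th1 r.
Proof.
move=> vr; have /andP[_ h] := L_bounds x v.
by apply: (le_trans h); apply: th1_mono => //; exact: enorm_ge0.
Qed.

Let L_abs x v r : enorm v <= r -> `|L x 0 v| <= c0 + th1 r.
Proof.
move=> vr; have h1 := L_ub x vr; have h2 := L_lb x v.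
have h3 : 0 <= th1 r by apply: th1_ge0; apply: le_trans vr; exact: enorm_ge0.
by rewrite ler_norml; apply/andP; split; have := c00; lra.
Qed.

Let integrable_scale (D : set R) (c : R) (f : R -> R) : measurable D ->
  mu.-integrable D (EFin \o f) -> mu.-integrable D (EFin \o (fun s => c * f s)).
Proof. by move=> mD If; have := integrableZl _ c If; exact. Qed.

Let integrable_add (D : set R) (f g : R -> R) : measurable D ->
  mu.-integrable D (EFin \o f) -> mu.-integrable D (EFin \o g) ->
  mu.-integrable D (EFin \o (fun s => f s + g s)).
Proof. by move=> mD If Ig; have := integrableD _ If Ig; exact. Qed.

Let integrable_sub (D : set R) (f g : R -> R) : measurable D ->
  mu.-integrable D (EFin \o f) -> mu.-integrable D (EFin \o g) ->
  mu.-integrable D (EFin \o (fun s => f s - g s)).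
Proof. by move=> mD If Ig; have := integrableB _ If Ig; exact. Qed.

(** * A priori bounds, uniform for times between [a] and [b] *)

Section time_window.
Variables (a b : R).
Hypotheses (a0 : 0 < a).
(** [e0] bounds the integrating factors and their inverses, [T1] the Lagrangian at [r = 0] along
    segments (speed at most [Rad / a]), [C1] the terminal value on the segment and hence on a
    minimizer, [C4] the integral of [L (xi, 0, xi') + c0], and [U] the solution [u] on the whole
    interval. None of them depends on [t]. *)
Let e0 := expR (K * b).
Let T1 := c0 + th1 (Rad / a).
Let C1 := e0 * (`|u0| + e0 * T1 * b).
Let C4 := e0 * (e0 * C1 + `|u0| + c0 * (e0 * b)).
Let U := e0 * (`|u0| + e0 * (C4 + c0 * b)).

Section fixed_time.
Variable t : R.
Hypotheses (at_ : a <= t) (tb : t <= b).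

Let t0 : 0 < t. Proof. exact: lt_le_trans at_. Qed.
Let b0 : 0 < b. Proof. exact: lt_le_trans tb. Qed.
Let e0_gt0 : 0 < e0. Proof. exact: expR_gt0. Qed.
Let tt : 0 <= t <= t. Proof. by rewrite lexx ltW. Qed.
Let T1_ge0 : 0 <= T1.
Proof. by rewrite addr_ge0// th1_ge0// ltW// divr_gt0. Qed.
Let C1_ge0 : 0 <= C1.
Proof. by rewrite mulr_ge0 ?(ltW e0_gt0)// addr_ge0// !mulr_ge0 ?(ltW e0_gt0) ?(ltW b0). Qed.

(** It serves twice: for [u] with [k = K], and for the difference of two solutions with
    [k = K * al]. In both cases the integral of [k] is at most [K * b], which gives the same bounds
    on the factor. *)
Lemma integrating_factor (D d h k : R -> R) : primitive 0 t D d ->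
  mu.-integrable `[0, t] (EFin \o h) -> mu.-integrable `[0, t] (EFin \o k) ->
  (forall s, 0 <= s <= t -> `|d s - h s| <= k s * `|D s|) ->
  (forall s, 0 <= s <= t -> 0 <= k s) ->
  (forall s, 0 <= s <= t -> \int[mu]_(x in `[0, s]) k x <= K * b) ->
  exists E : R -> R, [/\ mu.-integrable `[0, t] (EFin \o (fun s => E s * h s)),
    forall s, 0 <= s <= t -> e0^-1 <= E s <= e0,
    {within `[0, t], continuous E} &
    forall s, 0 <= s <= t -> E s * D s = D 0 + \int[mu]_(x in `[0, s]) (E x * h x)].
Proof.
move=> HD Ih Ik Hk k0 kKb.
have [Lam [cLam HLam HF]] := variation_of_constants HD Ih Ik Hk k0.
have cE : {within `[0, t], continuous (fun s => expR (- Lam s))}.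
  apply/subspace_continuousP => s sab.
  have /subspace_continuousP/(_ s sab) := cLam.
  by move=> h1; apply: continuous_cvg; [exact: continuous_expR|exact: cvgN h1].
exists (fun s => expR (- Lam s)); split => //.
- have := integrable_mul_continuous Ih cE.
  by apply: eq_integrable => // s _ /=; rewrite mulrC.
- move=> s st; have := le_trans (HLam s st) (kKb s st).
  by rewrite ler_norml => /andP[h1 h2]; rewrite /e0 -expRN !ler_expR; lra.
- by move=> s st; rewrite HF// mulrA -expRD addNr expR0 mul1r.
Qed.

Section along_curve.
Variables (xi g : R -> V) (u : R -> R).
Hypothesis mxi : forall i, measurable_fun `[0, t] (fun s => xi s 0 i).
Hypothesis mg : forall i, measurable_fun `[0, t] (fun s => g s 0 i).
Hypothesis Hu : primitive 0 t u (fun s => L (xi s) (u s) (g s)).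
Let h s := L (xi s) 0 (g s).

Let uL s : `|L (xi s) (u s) (g s) - h s| <= K * `|u s|.
Proof. by have := LK (xi s) (g s) (u s) 0; rewrite subr0. Qed.

Lemma zero_lagrangian_integrable : mu.-integrable `[0, t] (EFin \o h).
Proof.
have [C C0 HC] := continuous_within_bounded (primitive_continuous Hu).
apply: (@integrable_dominated _ _ _ (fun s => `|L (xi s) (u s) (g s)| + K * C)) => //.
- exact: (measurable_lagrangian cL mxi (measurable_cst (0 : R)) mg).
- by apply: integrable_add => //; [exact: integrable_norm Hu.1|exact: integrable_cst_itv].
move=> s; rewrite /= in_itv/= => st; have := uL s; rewrite distrC => h1.
have : K * `|u s| <= K * C by rewrite ler_wpM2l ?HC.
have := ler_normD (h s - L (xi s) (u s) (g s)) (L (xi s) (u s) (g s)); rewrite subrK.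
lra.
Qed.

Lemma herglotz_formula : exists E : R -> R,
  [/\ mu.-integrable `[0, t] (EFin \o (fun s => E s * h s)),
    forall s, 0 <= s <= t -> e0^-1 <= E s <= e0,
    {within `[0, t], continuous E} &
    forall s, 0 <= s <= t -> E s * u s = u 0 + \int[mu]_(x in `[0, s]) (E x * h x)].
Proof.
apply: (integrating_factor Hu zero_lagrangian_integrable (integrable_cst_itv 0 t K)) => //.
move=> s /andP[s0 st]; rewrite Rintegral_cst_itv// subr0 ler_wpM2l//.
exact: le_trans st tb.
Qed.

Lemma factor_le (E z : R) : e0^-1 <= E <= e0 -> `|z| <= e0 * `|E * z|.
Proof.
move=> /andP[h1 h2]; have E0 : 0 < E by rewrite (lt_le_trans _ h1)// invr_gt0.
rewrite normrM (gtr0_norm E0) mulrA ler_peMl//.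
by rewrite -(mulfV (lt0r_neq0 e0_gt0)) ler_pM2l.
Qed.

Lemma terminal_le r : (forall s, enorm (g s) <= r) -> c0 + th1 r <= T1 -> u 0 = u0 -> u t <= C1.
Proof.
move=> gr rT uu0; have [E [IE Eb _ HE]] := herglotz_formula.
apply: (le_trans (ler_norm _)); apply: (le_trans (factor_le _ (Eb t tt))).
rewrite ler_pM2l// HE// uu0 (le_trans (ler_normD _ _))// lerD2l.
have -> : e0 * T1 * b = e0 * T1 * (b - 0) by rewrite subr0.
apply: (@le_trans _ _ (e0 * T1 * (t - 0))); last first.
  by rewrite ler_wpM2l ?lerD2r ?mulr_ge0 ?(ltW e0_gt0).
rewrite -(Rintegral_cst_itv _ (ltW t0)); apply: norm_Rintegral_le => //.
  exact: integrable_cst_itv.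
move=> s; rewrite /= in_itv/= => st; rewrite normrM.
have /andP[E1 E2] := Eb s st.
have E0 : 0 <= E s by rewrite (le_trans _ E1)// invr_ge0 ltW.
by rewrite ger0_norm// ler_pM// (le_trans (L_abs _ (gr s))).
Qed.

(** A one-sided bound on the terminal value suffices because [h + c0] is nonnegative: the formula
    for [E t * u t] bounds its weighted integral. That integral then controls [u] at all
    intermediate times through [|h| <= h + 2 c0]. *)
Lemma a_priori : u 0 = u0 -> u t <= C1 ->
  \int[mu]_(s in `[0, t]) (h s + c0) <= C4 /\ forall s, 0 <= s <= t -> `|u s| <= U.
Proof.
move=> uu0 uC1; have [E [IE Eb cE HE]] := herglotz_formula.
have Ih := zero_lagrangian_integrable.
have Ip : mu.-integrable `[0, t] (EFin \o (fun s => h s + c0)).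
  by apply: integrable_add => //; exact: integrable_cst_itv.
have p0 s : 0 <= h s + c0 by have := L_lb (xi s) (g s); rewrite /h; lra.
have IE0 : mu.-integrable `[0, t] (EFin \o E).
  by apply: continuous_compact_integrable => //; exact: segment_compact.
have E0 s : 0 <= s <= t -> 0 < E s.
  by move=> st; have /andP[E1 _] := Eb s st; rewrite (lt_le_trans _ E1)// invr_gt0.
have IEp : mu.-integrable `[0, t] (EFin \o (fun s => E s * (h s + c0))).
  have := integrable_add (measurable_itv _) IE (integrable_scale c0 (measurable_itv _) IE0).
  by apply: eq_integrable => // s _ /=; congr (_%:E); ring.
have H1 : \int[mu]_(s in `[0, t]) (h s + c0) <= C4.
  apply: (@le_trans _ _ (\int[mu]_(s in `[0, t]) (e0 * (E s * (h s + c0))))).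
    apply: le_Rintegral => //; first exact: integrable_scale.
    move=> s; rewrite /= in_itv/= => st.
    by have := factor_le (h s + c0) (Eb s st); rewrite !ger0_norm// mulr_ge0// ltW// E0.
  rewrite RintegralZl// ler_pM2l//.
  have -> : \int[mu]_(s in `[0, t]) (E s * (h s + c0)) =
      \int[mu]_(s in `[0, t]) (E s * h s) + c0 * \int[mu]_(s in `[0, t]) E s.
    rewrite -RintegralZl// -RintegralD//; last exact: integrable_scale.
    by apply: eq_Rintegral => s _; ring.
  apply: lerD; last first.
    rewrite ler_wpM2l//; apply: (@le_trans _ _ (\int[mu]_(s in `[0, t]) (cst e0 s))).
      apply: le_Rintegral => //; first exact: integrable_cst_itv.
      by move=> s; rewrite /= in_itv/= => /Eb/andP[].
    by rewrite Rintegral_cst_itv ?(ltW t0)// subr0 ler_pM2l.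
  have -> : \int[mu]_(s in `[0, t]) (E s * h s) = E t * u t - u0.
    by rewrite (HE t tt) uu0 addrAC subrr add0r.
  have h1 : E t * u t <= e0 * C1.
    have /andP[_ h2] := Eb t tt.
    apply: (@le_trans _ _ (E t * C1)); first by rewrite ler_pM2l ?E0.
    by rewrite ler_wpM2r.
  have := ler_norm (- u0); rewrite normrN; lra.
split => // s st; apply: (le_trans (factor_le _ (Eb s st))).
have s0 : 0 <= s by case/andP: st.
have s1 : s <= t by case/andP: st.
rewrite ler_pM2l// HE// uu0 (le_trans (ler_normD _ _))// lerD2l.
have Ipc : mu.-integrable `[0, t] (EFin \o (fun s => h s + c0 + c0)).
  by apply: integrable_add => //; exact: integrable_cst_itv.
have pc0 x : 0 <= h x + c0 + c0 by rewrite addr_ge0.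
apply: (@le_trans _ _ (\int[mu]_(x in `[0, s]) (e0 * (h x + c0 + c0)))).
  apply: norm_Rintegral_le => //.
  - exact: integrable_sub_itv IE.
  - by apply: (integrable_sub_itv (lexx 0) s1); exact: integrable_scale.
  move=> x; rewrite /= in_itv/= => xs.
  have xt : 0 <= x <= t by lra.
  have /andP[_ E2] := Eb x xt.
  rewrite normrM (gtr0_norm (E0 x xt)) ler_pM ?(ltW (E0 x xt))//.
  rewrite ler_norml; apply/andP; split; first by have := L_lb (xi x) (g x); rewrite -/(h x); lra.
  by rewrite -addrA lerDl addr_ge0.
rewrite RintegralZl//; last exact: integrable_sub_itv Ipc.
rewrite ler_pM2l//.
have le1 : \int[mu]_(x in `[0, s]) (h x + c0 + c0) <= \int[mu]_(x in `[0, t]) (h x + c0 + c0).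
  rewrite -subr_ge0 Rintegral_itv_sub//.
  by apply: Rintegral_ge0 => x _.
apply: (le_trans le1); rewrite RintegralD//; last exact: integrable_cst_itv.
rewrite lerD// (Rintegral_cst_itv _ (ltW t0)) subr0.
by rewrite ler_wpM2l.
Qed.

End along_curve.

(** Admissibility of the segment is itself an existence statement for the Herglotz equation;
    [picard] provides the solution, and [terminal_le] its size at time [t]. *)
Lemma segment_competitor (x0 x : V) : enorm (x - x0) <= Rad ->
  exists2 eta, admissible L x0 x t u0 eta & action L t u0 eta <= C1 - u0.
Proof.
move=> xx0; pose c : V := t^-1 *: (x - x0); pose l s : V := x0 + s *: c.
have cR : enorm c <= Rad / a.
  rewrite enormZ ger0_norm ?invr_ge0 ?(ltW t0)// mulrC.
  apply: (@le_trans _ _ (Rad * t^-1)); first by rewrite ler_wpM2r ?invr_ge0 ?(ltW t0).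
  by rewrite ler_pM2l// lef_pV2 ?posrE.
have Hl i : primitive 0 t (fun s => l s 0 i) (fun s => c 0 i).
  apply: derive_primitive; first by apply: continuous_subspaceT => s; exact: cvg_cst.
  move=> s _; have -> : (fun s => l s 0 i) = cst (x0 0 i) + (fun s : R => s) * cst (c 0 i).
    by apply/funext => y; rewrite /l !mxE.
  have := is_deriveD (is_derive_cst (x0 0 i) s 1) (is_deriveM (is_derive_id s 1) (is_derive_cst (c 0 i) s 1)).
  by move=> /is_derive_eq; apply; rewrite -![_ *: _]/(_ * _)/= mulr0 !add0r mulr1.
have ml i : measurable_fun `[0, t] (fun s => l s 0 i) by have [] := primitive_measurable (Hl i).
have mc i : measurable_fun `[0, t] (fun s : R => c 0 i) by exact: measurable_cst.
have mf w : measurable_fun `[0, t] w -> measurable_fun `[0, t] (fun s => L (l s) (w s) c).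
  by move=> mw; exact: (measurable_lagrangian (g := fun=> c) cL ml mw mc).
have If0 : mu.-integrable `[0, t] (EFin \o (fun s => L (l s) 0 c)).
  apply: (@integrable_dominated _ _ _ (cst (c0 + th1 (Rad / a)))) => //.
  - exact: (mf (cst 0) (measurable_cst _)).
  - exact: integrable_cst_itv.
  - by move=> s _; exact: L_abs.
have [w [w0 Hw]] := @picard R 0 t u0 (fun s r => L (l s) r c) (cst K) (ltW t0)
  (integrable_cst_itv 0 t K) (fun _ _ => K0) (fun s u v _ => LK (l s) c u v) If0 mf.
have l0 : l 0 = x0 by rewrite /l scale0r addr0.
have lt : l t = x by rewrite /l /c scalerA divff ?gt_eqF// scale1r addrC subrK.
have [Al Jl] := competitor cL LK L_lb K0 t0 (g := fun=> c) Hl Hw w0 l0 lt.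
exists l => //; rewrite Jl lerD2r.
exact: (terminal_le (g := fun=> c) ml mc Hw (fun=> cR)).
Qed.

(** * Cost of the reparametrization and contradiction with minimality *)

Section speed.
Variables (r0 q M : R).
Hypotheses (r01 : 1 <= r0) (r0C : 2 * C4 <= a * r0) (r0M : r0 <= M).
Hypothesis th0_r0 : forall r, r0 <= r -> r <= th0 r.
Hypothesis th0_M : forall r, M <= r -> q * r <= th0 r.
(** [B] gathers, per unit of [|v|], the errors on the fast set where [v] is replaced by a unit
    vector; [B'] bounds [L (x, r, 2 v) - 2 L (x, r, v)] for [|v| <= r0], the price of acceleration
    per unit of [d]. *)
Let B := th1 1 + 2 * K * U + c0.
Let B' := th1 (2 * r0) + 3 * K * U + 2 * c0.
Hypotheses (q0 : 0 < q) (qC : 4 * C4 <= a * q) (qB : B + e0 * e0 * B' < q).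

(* Slowing the curve down to unit speed where it is fast, and spending the lost
   time by a slight acceleration where it is slow. *)
Lemma reparametrization_cost (x v : V) (r al d : R) : `|r| <= U -> 0 <= d <= 1 / 2 ->
  al = 1 + ((M < enorm v)%R%:R * enorm v - (M < enorm v)%R%:R) - d * (enorm v <= r0)%R%:R ->
  al * L x r (al^-1 *: v) - L x r v <=
    - (q - B) * ((M < enorm v)%R%:R * enorm v) + d * B' * (enorm v <= r0)%R%:R.
Proof.
move=> rU d01; have U0 : 0 <= U by exact: le_trans (normr_ge0 r) rU.
have KrU : K * `|r| <= K * U by rewrite ler_wpM2l.
have dL y w : `|L y r w - L y 0 w| <= K * U.
  by apply: le_trans KrU; have := LK y w r 0; rewrite subr0.
have [vM|vM] := ltP M (enorm v).
  have -> : (enorm v <= r0) = false by apply/negbTE; rewrite -ltNge (le_lt_trans r0M).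
  have v1 : 1 <= enorm v by rewrite (le_trans r01)// (le_trans r0M)// ltW.
  have v0 : 0 < enorm v by rewrite (lt_le_trans ltr01).
  rewrite mul1r !mulr0 subr0 addr0 => alE; have {alE}-> : al = enorm v by rewrite alE addrC subrK.
  have n1 : enorm ((enorm v)^-1 *: v) <= 1.
    by rewrite enormZ ger0_norm ?invr_ge0 ?(ltW v0)// mulVf// gt_eqF.
  have h1 := L_ub x n1.
  have := dL x ((enorm v)^-1 *: v); rewrite ler_norml => /andP[_ h2].
  have := dL x v; rewrite ler_norml => /andP[h3 _].
  have /andP[h4 _] := L_bounds x v.
  have h5 := th0_M (ltW vM).
  have h6 : enorm v * L x r ((enorm v)^-1 *: v) <= enorm v * (th1 1 + K * U).
    by rewrite ler_pM2l//; lra.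
  have h7 : c0 + K * U <= enorm v * (c0 + K * U) by rewrite ler_peMl// addr_ge0// mulr_ge0.
  rewrite /B; set N := enorm v in h4 h5 h6 h7 *.
  have -> : - (q - (th1 1 + 2 * K * U + c0)) * N = N * (th1 1 + K * U) + N * (c0 + K * U) - q * N by ring.
  lra.
rewrite !mul0r subrr addr0 mulr0 add0r; have [vr|vr] := leP (enorm v) r0; last first.
  by rewrite !mulr0 subr0 => ->; rewrite invr1 mul1r scale1r subrr.
(* Subtracting [L x r v] from the convexity estimate leaves [d * (L x r (2 *: v) - 2 * L x r v)], of
   first order in [d]. *)
rewrite !mulr1 => ->; have h1 := convex_speed_up v (convL x r) d01.
have /andP[d0 _] := d01.
have n2 : enorm (2 *: v) <= 2 * r0 by rewrite enormZ ger0_norm// ler_pM2l.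
have h2 := L_ub x n2.
have := dL x (2 *: v); rewrite ler_norml => /andP[_ h3].
have := dL x v; rewrite ler_norml => /andP[h4 _].
have h5 := L_lb x v.
have : d * (L x r (2 *: v) - 2 * L x r v) <= d * B'.
  by apply: ler_wpM2l => //; rewrite /B'; lra.
rewrite mulrBr mulrA; lra.
Qed.

Lemma speed_bound (x0 x : V) (xi : R -> V) : enorm (x - x0) <= Rad ->
  minimizer L x0 x t u0 xi ->
  {ae mu, forall s, s \in `[0, t] -> enorm (weak_derivative 0 t xi s) <= M}.
Proof.
move=> xx0 Hxi.
have [u [Hu uu0 Pxi [xi0 xit] Hmin]] := minimizer_primitive cL LK L_lb K0 t0 Hxi.
have uC1 : u t <= C1.
  have [eta Aeta Jeta] := segment_competitor xx0.
  by have := le_trans (Hmin _ Aeta) Jeta; rewrite lerD2r.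
pose v := weak_derivative 0 t xi; rewrite -/v in Hu Pxi *.
have mxi i : measurable_fun `[0, t] (fun s => xi s 0 i) by have [] := primitive_measurable (Pxi i).
have mv i : measurable_fun `[0, t] (fun s => v s 0 i) by have [] := primitive_measurable (Pxi i).
have [pC4 uU] := a_priori mxi mv Hu uu0 uC1.
have Ih := zero_lagrangian_integrable mxi mv Hu.
have mu_ : measurable_fun `[0, t] u by have [] := primitive_measurable Hu.
pose N s := enorm (v s).
have mN : measurable_fun `[0, t] N by exact: measurable_enorm.
pose p s := L (xi s) 0 (v s) + c0.
have Ip : mu.-integrable `[0, t] (EFin \o p).
  by apply: integrable_add => //; exact: integrable_cst_itv.
have pth s : th0 (N s) <= p s by have /andP[h _] := L_bounds (xi s) (v s); rewrite /p /N; lra.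
have N0 s : 0 <= N s by exact: enorm_ge0.
have p0 s : 0 <= p s by apply: le_trans (pth s); exact: th0_ge0.
have M1 : 1 <= M by exact: le_trans r0M.
have r0_gt0 : 0 < r0 by exact: lt_le_trans r01.
pose E := `[0, t]%classic `&` N @^-1` `]M, +oo[.
pose S := `[0, t]%classic `&` N @^-1` `]-oo, r0].
have mE : measurable E by exact: mN.
have mS : measurable S by exact: mN.
pose iE : R -> R := \1_E; pose iS : R -> R := \1_S.
have iEE s : 0 <= s <= t -> iE s = (M < N s)%R%:R.
  move=> st; rewrite /iE indicE; have -> // : (s \in E) = (M < N s).
  apply/idP/idP => [|h].
    by rewrite inE => -[_]; rewrite /= in_itv/= andbT.
  by rewrite inE; split; rewrite /= in_itv/= ?andbT.
have iSE s : 0 <= s <= t -> iS s = (N s <= r0)%R%:R.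
  move=> st; rewrite /iS indicE; have -> // : (s \in S) = (N s <= r0).
  apply/idP/idP => [|h].
    by rewrite inE => -[_]; rewrite /= in_itv/=.
  by rewrite inE; split; rewrite /= in_itv/=.
have miE : measurable_fun `[0, t] iE by exact: measurable_indic.
have miS : measurable_fun `[0, t] iS by exact: measurable_indic.
have I1 := integrable_cst_itv 0 t (1 : R).
have ind01 (A : set R) s : 0 <= (\1_A s : R) <= 1 by rewrite indicE ler0n lern1 leq_b1.
have IiE : mu.-integrable `[0, t] (EFin \o iE).
  apply: (integrable_dominated _ miE I1) => // s _ /=.
  by have /andP[h1 h2] := ind01 E s; rewrite ger0_norm.
have IiS : mu.-integrable `[0, t] (EFin \o iS).
  apply: (integrable_dominated _ miS I1) => // s _ /=.
  by have /andP[h1 h2] := ind01 S s; rewrite ger0_norm.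
pose e s := iE s * N s.
have e_ge0 s : 0 <= e s by rewrite mulr_ge0//; have /andP[] := ind01 E s.
have qe s : 0 <= s <= t -> q * e s <= p s.
  move=> st; rewrite /e iEE//; have [vM|vM] := ltP M (N s); last by rewrite mul0r mulr0.
  by rewrite mul1r (le_trans _ (pth s))// th0_M// ltW.
have Ie : mu.-integrable `[0, t] (EFin \o e).
  apply: (integrable_dominated _ _ (integrable_scale q^-1 (measurable_itv _) Ip)) => //.
    exact: measurable_funM.
  move=> s; rewrite /= in_itv/= => st; rewrite ger0_norm// mulrC ler_pdivlMr// mulrC.
  exact: qe.
have muE : (\int[mu]_(s in `[0%R, t]) (iE s)%:E = mu E)%E.
  rewrite integral_indic//; congr (mu _).
  by apply/seteqP; split => s [] // [].
(* If [E] is null it serves as the exceptional set; its positive measure is otherwise what makes the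
   final inequality strict. *)
have [iE0|iE0] := leP (\int[mu]_(s in `[0, t]) iE s) 0.
  exists E; split => //.
    have fE : mu E \is a fin_num.
      by rewrite -muE; apply: integrable_fin_num => //; exact: IiE.
    apply/eqP; rewrite eq_le measure_ge0 andbT -(fineK fE) lee_fin -muE.
    exact: iE0.
  move=> s /= /not_implyP[st /negP]; rewrite -ltNge => h; split => //.
  by rewrite /= in_itv/= andbT.
exfalso.
have eE : \int[mu]_(s in `[0, t]) iE s <= \int[mu]_(s in `[0, t]) e s.
  apply: le_Rintegral => // s; rewrite /= in_itv/= => st; rewrite /e iEE//.
  have [vM|vM] := ltP M (N s); last by rewrite mul0r.
  by rewrite mul1r (le_trans M1)// ltW.
have qIe : q * \int[mu]_(s in `[0, t]) e s <= C4.
  rewrite -RintegralZl//; apply: le_trans pC4.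
  by apply: le_Rintegral => //; exact: integrable_scale.
(* Chebyshev's inequality: off [S] the integrand [p] is at least [r0]. With [r0C] this leaves at
   most [a / 2 <= t / 2] of the time outside [S]. *)
have Sr : r0 * (t - \int[mu]_(s in `[0, t]) iS s) <= C4.
  have -> : t - \int[mu]_(s in `[0, t]) iS s = \int[mu]_(s in `[0, t]) (cst 1 s - iS s).
    by rewrite RintegralB// (Rintegral_cst_itv _ (ltW t0)) subr0 mul1r.
  rewrite -RintegralZl//; last exact: integrable_sub.
  apply: le_trans pC4; apply: le_Rintegral => //.
    by apply: integrable_scale => //; exact: integrable_sub.
  move=> s; rewrite /= in_itv/= => st; rewrite iSE//.
  have [vr|vr] := leP (N s) r0; first by rewrite /= subrr mulr0 p0.
  rewrite /= subr0 mulr1 (le_trans (ltW vr))// (le_trans _ (pth s))//.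
  by apply: th0_r0; exact: ltW.
set Im := \int[mu]_(s in `[0, t]) iE s in iE0 eE.
set Ies := \int[mu]_(s in `[0, t]) e s in eE qIe.
set Sm := \int[mu]_(s in `[0, t]) iS s in Sr.
have Sm2 : t / 2 <= Sm.
  have : r0 * (t - Sm) <= r0 * (a / 2) by have := r0C; lra.
  by rewrite ler_pM2l//; have := at_; lra.
have Sm0 : 0 < Sm by apply: lt_le_trans Sm2; rewrite divr_gt0.
have Ie4 : Ies <= a / 4.
  have : q * Ies <= q * (a / 4) by have := qC; lra.
  by rewrite ler_pM2l.
(* Unit speed on [E] takes time [Ies] instead of [Im]; the delay is spread evenly over [S]. From
   [Ies <= a / 4] and [Sm >= t / 2] follows [d <= 1 / 2], so the acceleration ratio [1 / (1 - d)] is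
   at most 2. *)
pose d := (Ies - Im) / Sm.
have dSm : d * Sm = Ies - Im by rewrite divfK// gt_eqF.
have d01 : 0 <= d <= 1 / 2.
  rewrite divr_ge0 ?(ltW Sm0) ?subr_ge0//= ler_pdivrMr//.
  by have := at_; lra.
pose al s := 1 + (e s - iE s) - d * iS s.
have Ial : mu.-integrable `[0, t] (EFin \o al).
  apply: integrable_sub => //; last exact: integrable_scale.
  by apply: integrable_add => //; exact: integrable_sub.
have al_int : \int[mu]_(s in `[0, t]) al s = t.
  rewrite /al RintegralB//; last first.
  - exact: integrable_scale.
  - by apply: (integrable_add _ I1) => //; exact: integrable_sub.
  rewrite RintegralD//; last exact: integrable_sub.
  rewrite (Rintegral_cst_itv _ (ltW t0)) RintegralB// RintegralZl// -/Ies -/Im -/Sm dSm.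
  by rewrite subr0 mul1r addrK.
have alE s : 0 <= s <= t -> al s =
    1 + ((M < N s)%R%:R * N s - (M < N s)%R%:R) - d * (N s <= r0)%R%:R.
  by move=> st; rewrite /al /e iEE// iSE.
have al_cases s : 0 <= s <= t -> [\/ al s = N s /\ M < N s, al s = 1 - d /\ N s <= r0 |
    al s = 1 /\ N s <= M].
  move=> st; rewrite alE//; have [vM|vM] := ltP M (N s).
    constructor 1; split => //.
    have -> : (N s <= r0) = false by apply/negbTE; rewrite -ltNge (le_lt_trans r0M).
    by rewrite mul1r mulr0 subr0 addrC subrK.
  have [vr|vr] := leP (N s) r0.
    by constructor 2; split => //; rewrite mul0r subrr addr0 mulr1.
  by constructor 3; split => //; rewrite mul0r subrr addr0 mulr0 subr0.
have al_ge s : 0 <= s <= t -> 1 / 2 <= al s.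
  by move=> /al_cases[[-> ?]|[-> ?]|[-> ?]]; have := M1; lra.
(* A common bound for the new speed [N / al]: it is 1 on the fast set, at most [2 * r0] on the slow
   one and at most [M] in between. *)
pose P := M + 2 * r0.
have NP s : 0 <= s <= t -> N s <= P * al s.
  have P1 : 1 <= P by rewrite /P; lra.
  move=> st; have [[-> ?]|[-> ?]|[-> ?]] := al_cases s st.
  - by rewrite ler_peMl.
  - apply: (@le_trans _ _ (P * (1 / 2))); first by rewrite /P; lra.
    by rewrite ler_wpM2l//; lra.
  - by rewrite mulr1 /P; lra.
have al0 s : 0 <= s <= t -> 0 < al s by move=> st; have := al_ge s st; lra.
have nP s : 0 <= s <= t -> enorm ((al s)^-1 *: v s) <= P.
  move=> st; have al1 := al0 s st; rewrite enormZ ger0_norm ?invr_ge0 ?(ltW al1)//.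
  by rewrite mulrC ler_pdivrMr// NP.
(* The Herglotz equation of the new curve written in the old time; its Lipschitz constant in [r] is
   [K * al s], integrable but not bounded. *)
pose f s r := al s * L (xi s) r ((al s)^-1 *: v s).
pose T := c0 + th1 P.
have mal : measurable_fun `[0, t] al by have /measurable_int/measurable_EFinP := Ial.
have mf w : measurable_fun `[0, t] w -> measurable_fun `[0, t] (fun s => f s (w s)).
  move=> mw; apply: measurable_funM => //.
  apply: (measurable_lagrangian (g := fun s => (al s)^-1 *: v s) cL mxi mw) => i.
  have -> : (fun s => ((al s)^-1 *: v s) 0 i) = (fun s => (al s)^-1 * v s 0 i).
    by apply/funext => s; rewrite mxE.
  by apply: measurable_funM => //; apply: measurableT_comp mal; exact: measurable_inv.
have fK s r r' : 0 <= s <= t -> `|f s r - f s r'| <= K * al s * `|r - r'|.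
  move=> st; have al1 := al0 s st; rewrite /f -mulrBr normrM gtr0_norm//.
  by rewrite [K * _]mulrC -mulrA ler_pM2l//; exact: LK.
have fT s r : 0 <= s <= t -> `|f s r| <= (T + K * `|r|) * al s.
  move=> st; have al1 := al0 s st; rewrite /f normrM gtr0_norm// mulrC ler_pM2r//.
  have h1 := L_abs (xi s) (nP s st).
  have := LK (xi s) ((al s)^-1 *: v s) r 0; rewrite subr0 => h2.
  have := ler_normD (L (xi s) r ((al s)^-1 *: v s) - L (xi s) 0 ((al s)^-1 *: v s)) (L (xi s) 0 ((al s)^-1 *: v s)).
  by rewrite subrK /T; lra.
have If (w : R -> R) C : measurable_fun `[0, t] w -> (forall s, 0 <= s <= t -> `|w s| <= C) ->
    mu.-integrable `[0, t] (EFin \o (fun s => f s (w s))).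
  move=> mw wC; apply: (integrable_dominated _ (mf w mw) (integrable_scale (T + K * C) (measurable_itv _) Ial)) => //.
  move=> s; rewrite /= in_itv/= => st; apply: (le_trans (fT s _ st)).
  by rewrite ler_pM2r ?al0// lerD2l ler_wpM2l ?wC.
have If0 : mu.-integrable `[0, t] (EFin \o (fun s => f s 0)).
  by apply: (If (cst 0) 0); [exact: measurable_cst|move=> s _; rewrite normr0].
have IKal := integrable_scale K (measurable_itv _) Ial.
have Kal0 s : 0 <= s <= t -> 0 <= K * al s by move=> st; rewrite mulr_ge0// ltW// al0.
have [w [w0 Hw]] := @picard R 0 t u0 f (fun s => K * al s) (ltW t0) IKal Kal0
  (fun s r r' st => fK s r r' st) If0 mf.
have [C C0 wC] := continuous_within_bounded (primitive_continuous Hw).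
have [tau [tau0 taut tau_in Htau]] := time_change t0 Ial al_ge al_int.
have Heta i : primitive 0 t (fun s => xi (tau s) 0 i) (fun s => ((al (tau s))^-1 *: v (tau s)) 0 i).
  have := Htau P _ _ (Pxi i).
  have vP s : 0 <= s <= t -> `|v s 0 i| <= P * al s.
    by move=> st; rewrite (le_trans (coord_le_enorm _ _))// NP.
  move=> /(_ vP); apply: primitive_ext => // s st.
  by rewrite mxE mulrC.
have Hue : primitive 0 t (fun s => w (tau s))
    (fun s => L (xi (tau s)) (w (tau s)) ((al (tau s))^-1 *: v (tau s))).
  have := Htau (T + K * C) _ _ Hw.
  have fC s : 0 <= s <= t -> `|f s (w s)| <= (T + K * C) * al s.
    move=> st; apply: (le_trans (fT s _ st)).
    by rewrite ler_pM2r ?al0// lerD2l ler_wpM2l ?wC.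
  move=> /(_ fC); apply: primitive_ext => // s st.
  by rewrite /f mulrAC divff ?mul1r// gt_eqF// al0// tau_in.
have wt0 : w (tau 0) = u0 by rewrite tau0.
have xt0 : xi (tau 0) = x0 by rewrite tau0.
have xtt : xi (tau t) = x by rewrite taut.
have [Aeta Jeta] := competitor (x0 := x0) (x := x) (xi := fun s => xi (tau s))
  (g := fun s => (al (tau s))^-1 *: v (tau s)) cL LK L_lb K0 t0 Heta Hue wt0 xt0 xtt.
have uw : u t <= w t by have := Hmin _ Aeta; rewrite Jeta taut lerD2r.
(* The source is evaluated at the old [u], where [U] is available; replacing [w] by [u] inside [f]
   costs [K * al s * |w - u|], which the integrating factor absorbs. *)
pose bb s := f s (u s) - L (xi s) (u s) (v s).
have Ibb : mu.-integrable `[0, t] (EFin \o bb).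
  by apply: integrable_sub => //; [exact: (If u U)|exact: Hu.1].
have HD := primitive_sub Hw Hu.
have Db s : 0 <= s <= t -> `|f s (w s) - L (xi s) (u s) (v s) - bb s| <= K * al s * `|w s - u s|.
  move=> st; have -> : f s (w s) - L (xi s) (u s) (v s) - bb s = f s (w s) - f s (u s).
    by rewrite /bb; ring.
  exact: fK.
have kKb s : 0 <= s <= t -> \int[mu]_(x in `[0, s]) (K * al x) <= K * b.
  move=> /andP[s0 st]; have Is := integrable_sub_itv (lexx 0) st Ial.
  rewrite RintegralZl// ler_wpM2l// (le_trans _ tb)// -[X in _ <= X]al_int.
  rewrite -subr_ge0 Rintegral_itv_sub//.
  by apply: Rintegral_ge0 => y; rewrite /= in_itv/= => ys; apply/ltW/al0; lra.
have [Ef [IEf Eb _ HE]] := integrating_factor HD Ibb IKal Db Kal0 kKb.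
have B'0 : 0 <= B'.
  have U0 : 0 <= U by exact: le_trans (normr_ge0 _) (uU t tt).
  have h1 : 0 <= th1 (2 * r0) by apply: th1_ge0; rewrite mulr_ge0// ltW.
  have h3 : 0 <= 3 * K * U by apply: mulr_ge0 => //; apply: mulr_ge0.
  by have := c00; rewrite /B'; lra.
have qB0 : 0 <= q - B.
  have : 0 <= e0 * e0 * B' by rewrite !mulr_ge0// ltW.
  by move: qB; lra.
(* The factor [Ef] is bounded below by [1 / e0] where it multiplies the gain and above by [e0] where
   it multiplies the cost. *)
pose c1 := - (q - B) * e0^-1; pose c2 := e0 * (d * B').
have Ic1 : mu.-integrable `[0, t] (EFin \o (fun s => c1 * e s)) by exact: integrable_scale.
have Ic2 : mu.-integrable `[0, t] (EFin \o (fun s => c2 * iS s)) by exact: integrable_scale.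
have bound : \int[mu]_(s in `[0, t]) (Ef s * bb s) <= c1 * Ies + c2 * Sm.
  have -> : c1 * Ies + c2 * Sm = \int[mu]_(s in `[0, t]) (c1 * e s + c2 * iS s).
    by rewrite RintegralD// !RintegralZl.
  apply: le_Rintegral => //; first exact: integrable_add.
  move=> s; rewrite /= in_itv/= => st; have /andP[E1 E2] := Eb s st.
  have Ef0 : 0 <= Ef s by rewrite (le_trans _ E1)// invr_ge0 ltW.
  have cost := reparametrization_cost (xi s) (v := v s) (uU s st) d01 (alE s st).
  rewrite -/(N s) -iEE// -iSE// -/(e s) -/(f s (u s)) -/(bb s) in cost.
  have iS0 : 0 <= iS s by have /andP[] := ind01 S s.
  have /andP[d0 _] := d01.
  apply: (le_trans (ler_wpM2l Ef0 cost)); rewrite mulrDr; apply: lerD.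
    have X0 : 0 <= (q - B) * e s by apply: mulr_ge0.
    have -> : c1 * e s = - (e0^-1 * ((q - B) * e s)) by rewrite /c1; ring.
    have -> : Ef s * (- (q - B) * e s) = - (Ef s * ((q - B) * e s)) by ring.
    by rewrite lerN2; exact: ler_wpM2r X0 _ _ E1.
  have Y0 : 0 <= d * B' * iS s by apply: mulr_ge0 => //; apply: mulr_ge0.
  have -> : c2 * iS s = e0 * (d * B' * iS s) by rewrite /c2; ring.
  exact: ler_wpM2r Y0 _ _ E2.
have := HE t tt; rewrite /= w0 uu0 subrr add0r => HEt.
have h1 : 0 <= Ef t * (w t - u t).
  have /andP[E1 _] := Eb t tt; rewrite mulr_ge0 ?subr_ge0// (le_trans _ E1)// invr_ge0 ltW//.
(* As [d * Sm = Ies - Im <= Ies], the sum is at most [Ies * (e0 * B' - (q - B) / e0)], which is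
   negative by [qB]. *)
have h2 : c1 * Ies + c2 * Sm < 0.
  have -> : c1 * Ies + c2 * Sm = c1 * Ies + e0 * B' * (Ies - Im) by rewrite /c2 -dSm; ring.
  have I0 : 0 < Ies by exact: lt_le_trans eE.
  apply: (@le_lt_trans _ _ (c1 * Ies + e0 * B' * Ies)).
    by rewrite lerD2l ler_wpM2l ?mulr_ge0 ?(ltW e0_gt0)//; lra.
  rewrite -mulrDl pmulr_llt0// /c1 mulNr addrC subr_lt0 ltr_pdivlMr//.
  by rewrite mulrAC; move: qB; lra.
rewrite -HEt in bound.
by have := le_lt_trans (le_trans h1 bound) h2; rewrite ltxx.
Qed.

End speed.

End fixed_time.
(** [M] precedes [t] and the endpoints: [r0] is chosen from [C4] and [a], it determines [B'], these
    determine [q], and superlinearity of [th0] with slope [q] yields [M]. *)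
Lemma lipschitz_bound : exists M, forall t, a <= t -> t <= b ->
  forall (x0 x : V) (xi : R -> V), enorm (x - x0) <= Rad -> minimizer L x0 x t u0 xi ->
  {ae mu, forall s, s \in `[0, t] -> enorm (weak_derivative 0 t xi s) <= M}.
Proof.
have [r0 r0m th0r0] := th0_super 1 (Num.max 1 (2 * C4 / a)).
pose B := th1 1 + 2 * K * U + c0.
pose B' := th1 (2 * r0) + 3 * K * U + 2 * c0.
pose q := Num.max (Num.max 1 (4 * C4 / a)) (B + e0 * e0 * B' + 1).
have [M rM thM] := th0_super q r0.
exists M => t at_ tb x0 x xi xx0 Hxi.
have r01 : 1 <= r0 by apply: le_trans r0m; rewrite le_max lexx.
have r0C : 2 * C4 <= a * r0.
  by rewrite [a * _]mulrC -ler_pdivrMr//; apply: le_trans r0m; rewrite le_max lexx orbT.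
have hr r : r0 <= r -> r <= th0 r by move=> /th0r0; rewrite mul1r.
have q0 : 0 < q by rewrite (@lt_le_trans _ _ 1)// /q !le_max lexx.
have qC : 4 * C4 <= a * q.
  by rewrite [a * _]mulrC -ler_pdivrMr// /q !le_max lexx orbT.
have qB : B + e0 * e0 * B' < q.
  by rewrite (@lt_le_trans _ _ (B + e0 * e0 * B' + 1)) ?ltrDl// /q !le_max lexx !orbT.
exact: (speed_bound at_ tb r01 r0C rM hr thM q0 qC qB xx0 Hxi).
Qed.

End time_window.
End lipschitz_estimate.

(** * From locally uniform bounds to one continuous monotone function *)

Section majorant.
Context {R : realType}.

Lemma superlinear_ge (theta : R -> R) : superlinear theta -> forall q m : R,
  exists2 M, m <= M & forall r, M <= r -> q * r <= theta r.
Proof.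
move=> /cvgryPge H q m; have [M [_ HM]] := H q.
exists (Num.max m (Num.max M 0 + 1)); first by rewrite le_max lexx.
move=> r; rewrite ge_max => /andP[_ Mr].
have Mr' : M < r by rewrite (lt_le_trans _ Mr)// (@le_lt_trans _ _ (Num.max M 0)) ?le_max ?lexx// ltrDl.
have r0 : 0 < r by rewrite (lt_le_trans _ Mr)// (@le_lt_trans _ _ (Num.max M 0)) ?le_max ?lexx ?orbT// ltrDl.
by rewrite -ler_pdivlMr//; exact: HM.
Qed.

Variable C : nat -> R.

(** A sum of hinges, each continuous and nondecreasing. The hinge of index [k] reaches height
    [|C k|] at [k + 1], whence the shift in [h_ge]. Up to a given [s] only finitely many are
    nonzero, so [h] coincides locally with a finite sum. *)
Let hn m (s : R) := \sum_(k < m) `|C k| * Num.max (s - k%:R) 0.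
Let h s := hn (Num.truncn s).+1 s.

Let term_ge0 k s : 0 <= `|C k| * Num.max (s - k%:R) 0.
Proof. by rewrite mulr_ge0// le_max lexx orbT. Qed.

Let hnE i j s : (i <= j)%N -> s <= i%:R -> hn j s = hn i s.
Proof.
move=> /subnK <-; elim: (j - i)%N => [|m IH] si; first by rewrite add0n.
rewrite addSn /hn big_ord_recr/= -/(hn _ _) IH// (max_idPr _) ?mulr0 ?addr0//.
by rewrite subr_le0 (le_trans si)// ler_nat leq_addl.
Qed.

Let hE m s : s <= m%:R -> h s = hn m s.
Proof.
move=> sm; have s1 : s <= (Num.truncn s).+1%:R.
  have [s0|s0] := leP 0 s; last by rewrite (le_trans (ltW s0)).
  by apply/ltW; have /andP[] := truncn_itv s0.
have [le|/ltnW le] := leqP (Num.truncn s).+1 m; first by rewrite [RHS](hnE le).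
by rewrite /h (hnE le).
Qed.

Let bound (s : R) : exists m : nat, s < m%:R.
Proof. by exists (Num.truncn `|s|).+1; rewrite (le_lt_trans (ler_norm s))//; have /andP[] := truncn_itv (normr_ge0 s). Qed.

Let h_ge0 s : 0 <= h s.
Proof. by apply: sumr_ge0. Qed.

Let h_mono s s' : s <= s' -> h s <= h s'.
Proof.
move=> ss'; have [m /ltW sm] := bound s'.
rewrite (hE sm) (hE (le_trans ss' sm)); apply: ler_sum => k _.
by rewrite ler_wpM2l// ge_max !le_max lexx orbT andbT lerD2r ss'.
Qed.

Let h_ge m s : m.+1%:R <= s -> C m <= h s.
Proof.
move=> ms; have [j sj] := bound s; rewrite (hE (ltW sj)).
have mj : (m < j)%N by rewrite -(ltr_nat R) (lt_trans _ sj)// (lt_le_trans _ ms)// ltr_nat.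
have ht : C m <= `|C m| * Num.max (s - m%:R) 0.
  apply: (le_trans (ler_norm _)); rewrite -{1}[`|C m|]mulr1; apply: ler_wpM2l => //.
  by rewrite le_max lerBrDl natr1 ms.
by apply: (le_trans ht); rewrite /hn (bigD1 (Ordinal mj))//= lerDl sumr_ge0.
Qed.

Let h_continuous : continuous h.
Proof.
move=> s; have [m sm] := bound s.
have cpos : continuous (fun z : R => Num.max z 0).
  by move=> y; apply: continuous_max; [exact: cvg_id|exact: cvg_cst].
have cn j : continuous (hn j).
  elim: j => [|j IH] x.
    have -> : hn 0 = cst 0 by apply/funext => y; rewrite /hn big_ord0.
    exact: cvg_cst.
  have -> : hn j.+1 = (fun y => hn j y + `|C j| * Num.max (y - j%:R) 0).
    by apply/funext => y; rewrite /hn big_ord_recr.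
  apply: cvgD; first exact: IH.
  apply: cvgM; first exact: cvg_cst.
  have cp : continuous ((fun z : R => Num.max z 0) \o (fun z : R => z - j%:R)).
    move=> y; apply: continuous_comp; last exact: cpos.
    by apply: cvgB; [exact: cvg_id|exact: cvg_cst].
  exact: cp.
rewrite /continuous_at (hE (ltW sm)); apply: cvg_trans (cn m s).
apply: near_eq_cvg; near=> z; rewrite (@hE m z)//; apply/ltW.
by near: z; exact: lt_nbhsl.
Unshelve. all: by end_near. Qed.

(* On the curve [r = Rad / t] a bound that is only locally uniform in [t > 0]
   is dominated by a function of [t + r / Rad = t + 1 / t]. *)
Lemma majorant (Rad : R) : 0 < Rad -> exists F : R -> R -> R,
    [/\ {within [set p : R * R | 0 <= p.1 /\ 0 <= p.2],
          continuous (fun p : R * R => F p.1 p.2)},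
        forall t r, 0 <= t -> 0 <= r -> 0 <= F t r,
        forall t1 t2 r, 0 <= t1 -> t1 <= t2 -> 0 <= r -> F t1 r <= F t2 r,
        forall t r1 r2, 0 <= t -> 0 <= r1 -> r1 <= r2 -> F t r1 <= F t r2
      & forall t, 0 <= t -> superlinear (F t)] /\
  forall t, 0 < t -> exists m, m.+1%:R^-1 <= t <= m.+1%:R /\ C m <= F t (Rad / t).
Proof.
(* The square provides superlinearity in [r] whatever the growth of [h]; the shift by 2 covers the
   rounding of [t + 1 / t] and the index shift of [h_ge]. *)
move=> Rad0; exists (fun t r => h (t + r / Rad + 2) + r * r); split; first split.
- apply: continuous_subspaceT => p.
  have c1 : {for p, continuous (fun p : R * R => p.1)} by exact: cvg_fst.
  have c2 : {for p, continuous (fun p : R * R => p.2)} by exact: cvg_snd.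
  apply: cvgD; last exact: cvgM.
  apply: (@continuous_comp _ _ _ (fun p : R * R => p.1 + p.2 / Rad + 2) h); last exact: h_continuous.
  apply: cvgD; last exact: cvg_cst.
  by apply: cvgD => //; apply: cvgM => //; exact: cvg_cst.
- by move=> t r t0 r0; rewrite addr_ge0 ?mulr_ge0.
- by move=> t1 t2 r t0 t12 r0; rewrite lerD2r h_mono// !lerD2r.
- move=> t r1 r2 t0 r0 r12; apply: lerD; last by rewrite ler_pM.
  by apply: h_mono; rewrite lerD2r lerD2l ler_pM2r ?invr_gt0.
- move=> t t0; apply/cvgryPge => A; near=> r.
  have r0 : 0 < r by near: r; exact: nbhs_pinfty_gt.
  rewrite ler_pdivlMr// (@le_trans _ _ (r * r))//.
    by rewrite ler_pM2r//; near: r; exact: nbhs_pinfty_ge.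
  by rewrite lerDr.
move=> t t0; have ti0 : 0 < t^-1 by rewrite invr_gt0.
have z0 : 0 <= t + t^-1 by rewrite addr_ge0 ?ltW.
(* Since [t] and [1 / t] are both below [m + 1] for this [m], the time lies in the window of index
   [m]. *)
exists (Num.truncn (t + t^-1)); have /andP[tr1 tr2] := truncn_itv z0.
split.
  rewrite invf_ple ?posrE//; first by apply/andP; split; lra.
apply: (@le_trans _ _ (h (t + Rad / t / Rad + 2))); last first.
  by rewrite lerDl mulr_ge0// ltW// divr_gt0.
apply: h_ge; have -> : Rad / t / Rad = t^-1 by field; rewrite !gt_eqF.
by rewrite -!natr1; lra.
Unshelve. all: by end_near. Qed.

End majorant.

Theorem proposition2 (R : realType) (n : nat)
    (L : 'rV[R]_n -> R -> 'rV[R]_n -> R) (u0 Rad : R) :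
  lagrangian_C2 L -> cond_L1 L -> cond_L2' L -> cond_L3 L -> 0 < Rad ->
  exists F : R -> R -> R,
    [/\ {within [set p : R * R | 0 <= p.1 /\ 0 <= p.2],
          continuous (fun p : R * R => F p.1 p.2)},
        forall t r, 0 <= t -> 0 <= r -> 0 <= F t r,
        forall t1 t2 r, 0 <= t1 -> t1 <= t2 -> 0 <= r -> F t1 r <= F t2 r,
        forall t r1 r2, 0 <= t -> 0 <= r1 -> r1 <= r2 -> F t r1 <= F t r2
      & forall t, 0 <= t -> superlinear (F t)] /\
    forall (t : R) (x x0 : 'rV[R]_n), 0 < t -> enorm (x - x0) <= Rad ->
    forall xi : R -> 'rV[R]_n, minimizer L x0 x t u0 xi ->
      (ess_sup_on 0 t (fun s => enorm (weak_derivative 0 t xi s))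
         <= (F t (Rad / t))%:E)%E.
Proof.
move=> C2 L1 [[th1 [th0 [c0 [[th1_ge0 th1_mono _] [th0_ge0 _ th0_super] _ c00 Lb]]]] _] [K [K0 LK]] Rad0.
(* The windows from [1 / (m + 1)] to [m + 1] exhaust the positive times; each gives one constant
   [C m]. *)
have bnd (m : nat) : exists M, forall t : R, m.+1%:R^-1 <= t -> t <= m.+1%:R ->
    forall x0 x xi, enorm (x - x0) <= Rad -> minimizer L x0 x t u0 xi ->
    {ae (@lebesgue_measure R), forall s, s \in `[0, t] ->
      enorm (weak_derivative 0 t xi s) <= M}.
  have a0 : 0 < m.+1%:R^-1 :> R by rewrite invr_gt0.
  exact: (lipschitz_bound u0 (lagrangian_continuous C2) (lagrangian_lipschitz C2 LK)
    L1 Lb th0_ge0 th1_ge0 th1_mono (superlinear_ge th0_super) (ltW K0) (ltW c00) Rad0 _ a0).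
have [C HC] := choice bnd; have [F [HF HFC]] := majorant C Rad0.
exists F; split => // t x x0 t0 xx0 xi Hxi.
have [m [/andP[t1 t2] Cm]] := HFC t t0.
have [N [mN N0 subN]] := HC m t t1 t2 x0 x xi xx0 Hxi.
(* The measure in [ess_sup_on] is restricted to [[0, t]], so the complement of the interval may be
   added to the exceptional set. *)
apply/ess_supP; exists (N `|` ~` `[0, t]); split.
- by apply: measurableU => //; exact: measurableC.
- have : @lebesgue_measure R ((N `|` ~` `[0, t]) `&` `[0, t]) = 0%E; last exact.
  rewrite setIUl setICl setU0.
  by apply: (@subset_measure0 _ _ _ (@lebesgue_measure R) _ N) => //; exact: measurableI.
move=> s /= hs; have [st|st] := boolP (s \in `[0, t]); last by right; exact/negP.
left; apply: subN => /= h; apply: hs; rewrite lee_fin; apply: le_trans Cm; exact: h.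
Qed.
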